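(* Let $p\geq3$ be a prime and $m\geq 3$ an integer. Define $$\pi_p^{2,1}=p^{-1/p}\left(\zeta_{p^2}-\sum_{k=0}^{p-1}\frac{1}{[k!]}\zeta_{2(p-1)}^k p^{\frac{k}{p(p-1)}}\right),$$ $$\pi_p^{3,1}= \left(\zeta_{p^3}-1\right)^{-2p+2}\left(\zeta_{p^3}-\sum_{k=0}^{p-1}\frac{(-1)^k}{k!}\left(\pi_p^{2,1}\right)^k-\sum_{k=1}^{p-1}\frac{(-1)^k(k-H_k)}{k!}\left(\pi_p^{2,1}\right)^{p+k}\right),$$ and for $m\geq4$ recursively $$\pi_p^{m,1}= \left(\zeta_{p^m}-1\right)^{-2p+2}\left(\zeta_{p^m}-\sum_{k=0}^{p-1}\frac{(-1)^k}{k!}\left(\pi_p^{m-1,1}\right)^k-\sum_{k=1}^{p-1}\frac{(-1)^k\left(2k-H_k\right)}{k!}\left(\pi_p^{m-1,1}\right)^{p+k}\right).$$ Then $\pi_p^{m,1}$ is a uniformizer of the field $\mathbb{K}_p^{m,1}=\mathbb{Q}_p(\zeta_{p^m},p^{1/p})$.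
   Context: $\mathbb{L}_p=W(\bar{\mathbb{F}}_p)((p^{\mathbb{Q}}))$ is the $p$-adic Mal'cev–Neumann field: an algebraically closed complete valued field containing $W(\bar{\mathbb{F}}_p)[1/p]\supset\mathbb{Q}_p$, with elements $p^x$ ($x\in\mathbb{Q}$), $p^xp^y=p^{x+y}$, $p^1=p$, every element having a unique expansion $\sum_x[\alpha_x]p^x$ ($[\cdot]$ the Teichmüller lift) with well-ordered support; $v_p$ is the minimum of the support. $\alpha=\beta+O(p^r)$ means $v_p(\alpha-\beta)\ge r$. All fields are taken inside $\mathbb{L}_p$, and $p^{1/p}$ is the element $p^{1/p}$ of $\mathbb{L}_p$. $\zeta_{2(p-1)}$ is a fixed primitive $2(p-1)$-th root of unity in $W(\bar{\mathbb{F}}_p)$; $\frac1{[k!]}$ is the inverse Teichmüller lift of $k!\bmod p$; rationals $\frac1{k!}$, $H_k=\sum_{j=1}^k\frac1j$ lie in $\mathbb{Z}_{(p)}$. $\sigma_N=\sum_{k=N}^\infty p^{-1/p^k}$. For each $N\geq 2$, $\zeta_{p^N}$ denotes a primitive $p^N$-th root of unity in $\mathbb{L}_p$ satisfying \begin{align*} \zeta_{p^N}= & \sum_{k=0}^{p-1}\frac{(-1)^{Nk}}{k!}\zeta_{2(p-1)}^k p^{\frac{k}{p^{N-1}(p-1)}}+\sum_{k=0}^{p-1}\frac{(-1)^{N(k+1)}}{k!}\zeta_{2(p-1)}^{k+1}p^{\frac{k+p}{p^{N-1}(p-1)}}\sigma_N -\sum_{k=1}^{p-1}\frac{H_k}{k!}(-1)^{N(k+1)}\zeta_{2(p-1)}^{k+1}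 p^{\frac{k+p}{p^{N-1}(p-1)}}\\ & +\frac{1}{2}\zeta_{2(p-1)}^2 p^{\frac{2}{p^{N-2}(p-1)}}\sigma_N^2+\frac{(-1)^N}{2}\zeta_{2(p-1)}^3 p^{\frac{2}{p^{N-2}(p-1)}-\frac{p-2}{p^N(p-1)}}+O\left(p^{\frac{2}{p^{N-2}(p-1)}}\right) \end{align*} (such roots exist). *)

(* Defs.v *)
From mathcomp Require Import all_boot all_order all_algebra all_field.
From mathcomp Require Import boolp classical_sets constructive_ereal.
Set Implicit Arguments.
Unset Strict Implicit.
Unset Printing Implicit Defensive.
Import Order.TTheory GRing.Theory Num.Theory.
Local Open Scope classical_set_scope.
Local Open Scope ring_scope.

Definition Fpbar (p : nat) : countClosedFieldType :=
  projT1 (countable_algebraic_closure 'F_p).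

Section Support.
Variable k : nzRingType.
Implicit Types (f g : rat -> k).

Definition support_of f : set rat := [set x | f x != 0].

Definition is_least (A : set rat) (x : rat) : Prop :=
  A x /\ forall y, A y -> x <= y.

Definition well_ordered_support f : Prop :=
  forall A : set rat, A `<=` support_of f -> A !=set0 -> exists x, is_least A x.

Definition min_support f : \bar rat :=
  match pselect (exists x, is_least (support_of f) x) with
  | left e => (sval (cid e))%:E
  | right _ => +oo%E
  end.

Definition monomial (x : rat) (c : k) : rat -> k :=
  fun y => if y == x then c else 0.

End Support.

(* The p-adic Mal'cev-Neumann field W(Fpbar)((p^Q)), presented by its
   Teichmueller expansions: [hsum f] is the sum of [f x] p^x over the support
   of f (meaningful when that support is well-ordered), [coef a] is the family
   of coefficients of a, and the valuation is the least element of the support.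
   The meaning of the infinite sums is fixed by [hsum_monomial], [hsumD] and
   the valuation: for all r, hsum f differs from the sum of its terms of
   exponent < r by an element of valuation >= r.  For p prime these axioms
   determine the field up to isomorphism: residue field Fpbar, value group Q,
   v(p) = 1, and every pseudo-convergent family has a limit (in particular the
   field is complete), i.e. it is maximally complete. *)
Record malcevNeumann (p : nat) := MalcevNeumann {
  mn_field :> closedFieldType;
  teich : Fpbar p -> mn_field;
  ppow : rat -> mn_field;
  hsum : (rat -> Fpbar p) -> mn_field;
  coef : mn_field -> rat -> Fpbar p;
  teich_morph : monoid_morphism teich;
  ppow1 : ppow 1 = p%:R;
  ppowD : forall x y, ppow (x + y) = ppow x * ppow y;
  coef_wo : forall a, well_ordered_support (coef a);
  hsum_coef : forall a, hsum (coef a) = a;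
  coef_hsum : forall f, well_ordered_support f -> coef (hsum f) = f;
  hsum_monomial : forall x c, hsum (monomial x c) = teich c * ppow x;
  hsumD : forall f g, well_ordered_support f -> well_ordered_support g ->
    (forall x, f x = 0 \/ g x = 0) ->
    hsum (fun x => f x + g x) = hsum f + hsum g;
  mn_valM : forall a b,
    (min_support (coef (a * b)%R)
       = min_support (coef a) + min_support (coef b))%E;
  mn_valD : forall a b,
    (Order.min (min_support (coef a)) (min_support (coef b))
       <= min_support (coef (a + b)%R))%E;
  teichD : forall c d,
    (0 < min_support (coef (teich (c + d) - teich c - teich d)%R))%E }.

Section Lp.
Variables (p : nat) (L : malcevNeumann p).
Implicit Types (a b z : L) (zeta : nat -> L).

Definition vp a : \bar rat := min_support (coef a).

Definition eq_bigO a b (r : rat) : Prop := (r%:E <= vp (a - b)%R)%E.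

(* W(Fpbar) inside L: the series with exponents in N. *)
Definition witt_ring : set L :=
  [set a | support_of (coef a) `<=` [set n%:R | n in [set: nat]]].

(* Q_p inside the complete field L, as the closure of Q. *)
Definition Qp : set L :=
  [set a | forall r : rat, exists q : rat, eq_bigO a (ratr q) r].

Definition is_subfield (F : set L) : Prop :=
  [/\ F 1, forall a b, F a -> F b -> F (a - b)
    & forall a b, F a -> F b -> F (a / b)].

Definition adjoin (F S : set L) : set L := smallest is_subfield (F `|` S).

(* A generator of the maximal ideal of the valuation ring of F. *)
Definition is_uniformizer (F : set L) (t : L) : Prop :=
  [/\ F t, (0 < vp t)%E
    & forall a, F a -> (0 < vp a)%E ->
        exists b, [/\ F b, (0 <= vp b)%E & a = t * b]].

Definition harmonic (k : nat) : L := \sum_(1 <= j < k.+1) j%:R^-1.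

Definition sigma (N : nat) : L :=
  hsum L (fun x : rat =>
    if `[< exists2 k : nat, (N <= k)%N & x = - ((p ^ k)%:R^-1) >]
    then 1 else 0).

(* Here z stands for zeta_{2(p-1)}. *)
Definition zeta_approx z (N : nat) : L :=
  \sum_(0 <= k < p)
     (-1) ^+ (N * k) / k`!%:R * z ^+ k
       * ppow L (k%:R / (p ^ (N - 1) * (p - 1))%:R)
  + \sum_(0 <= k < p)
     (-1) ^+ (N * (k + 1)) / k`!%:R * z ^+ (k + 1)
       * ppow L ((k + p)%:R / (p ^ (N - 1) * (p - 1))%:R) * sigma N
  - \sum_(1 <= k < p)
     harmonic k / k`!%:R * (-1) ^+ (N * (k + 1)) * z ^+ (k + 1)
       * ppow L ((k + p)%:R / (p ^ (N - 1) * (p - 1))%:R)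
  + 2%:R^-1 * z ^+ 2 * ppow L (2%:R / (p ^ (N - 2) * (p - 1))%:R) * sigma N ^+ 2
  + (-1) ^+ N / 2%:R * z ^+ 3
     * ppow L (2%:R / (p ^ (N - 2) * (p - 1))%:R
               - (p - 2)%:R / (p ^ N * (p - 1))%:R).

Definition zeta_spec z zeta : Prop :=
  forall N : nat, (2 <= N)%N ->
    (p ^ N).-primitive_root (zeta N) /\
    eq_bigO (zeta N) (zeta_approx z N) (2%:R / (p ^ (N - 2) * (p - 1))%:R).

Definition pi2 z zeta : L :=
  ppow L (- (p%:R^-1)) *
  (zeta 2 - \sum_(0 <= k < p)
     (teich L k`!%:R)^-1 * z ^+ k * ppow L (k%:R / (p * (p - 1))%:R)).

Definition pi_step (c : nat) (zm a : L) : L :=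
  (zm - 1) ^- (2 * p - 2) *
  (zm - \sum_(0 <= k < p) (-1) ^+ k / k`!%:R * a ^+ k
      - \sum_(1 <= k < p)
          (-1) ^+ k * ((c * k)%:R - harmonic k) / k`!%:R * a ^+ (p + k)).

(* The element pi_p^{n+2,1}; the factor c of [pi_step] is 1 for the step from
   2 to 3 and 2 for all later steps. *)
Fixpoint pi_from2 z zeta (n : nat) : L :=
  if n is n'.+1 then
    pi_step (if n' is 0%N then 1 else 2) (zeta n'.+3) (pi_from2 z zeta n')
  else pi2 z zeta.

Definition pi_ z zeta (m : nat) : L := pi_from2 z zeta (m - 2).

Definition Km1 zeta (m : nat) : set L :=
  adjoin Qp [set zeta m; ppow L (p%:R^-1)].

End Lp.

(* Main.v *)
Require Import Defs.
From mathcomp Require Import all_boot all_order all_algebra all_field.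
From mathcomp Require Import boolp classical_sets constructive_ereal.
From mathcomp Require Import zify ring lra.
Set Implicit Arguments.
Unset Strict Implicit.
Unset Printing Implicit Defensive.
Import Order.TTheory GRing.Theory Num.Theory.
Local Open Scope classical_set_scope.
Local Open Scope ring_scope.

(** Put eps_N = 1/(p^(N-1)(p-1)), lam_N = (-1)^N zeta_{2(p-1)} p^(eps_N), mu_N = - lam_N^p and
    s_N = mu_N sigma_N.  The given expansion of zeta_{p^N} reads, with truncated exponential E,
    zeta = E(lam)(1 + s) - mu sum H_k lam^k/k! + s^2/2 + lam s^2/2 + O(p^(2 p eps_N)).
    By induction pi^{N,1} = lam_N sigma_N (1 + c lam_N) + O(p^(2 eps_N)), where c = 1 for N = 2
    and c = 2 afterwards.  Since lam_{N-1} = - mu_N and lam_{N-1} sigma_{N-1} = - (lam_N + s_N),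
    this says - pi^{N-1,1} = (lam + s)(1 - c mu) + O(p^(2 p eps_N)); Taylor expanding E around
    lam makes everything in the bracket defining pi^{N,1} cancel except mu s / lam + mu s, and
    the error bound reproduces itself.  Hence v(pi^{m,1}) = 1/(p^m (p-1)).

    This is the least positive valuation on Q_p(zeta_{p^m}, p^(1/p)): elements whose valuations
    are distinct mod Z are linearly independent over Q_p, and the field is spanned by
    p^m (p-1) elements.  Finally pi^{m,1} lies in the field because lam_2 does: with
    t = zeta_{p^2} - 1, lam_2^p is a limit of elements of Q_p[t], which is closed, and
    lam_2^(p-1) = - p^(1/p). *)

(** * Valuation and completeness *)

(** The constants of the recursion come from the bracket. Shifting the argument of E by - c mu (lam
    + s) costs c mu lam E'(lam), where E' is the truncation one term shorter. The parts c k of the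
    coefficients repay it, because sum k lam^k/k! = lam E'(lam), and the parts H_k remove the
    harmonic sum of zeta. Exactly one mu s survives whatever c was; the other survivor is s (E -
    E')(lam) = s lam^(p-1)/(p-1)!, which Wilson turns into mu s / lam. Then (zeta - 1)^(-2p+2) is
    split as (zeta - 1)^2 / (zeta - 1)^(2p): the denominator is mu^2 to the needed precision, the
    square brings a second factor 1 + lam, and (1 + lam)^2 explains the stable value c = 2. At level
    2 the divisor is the monomial p^(1/p) and only one factor 1 + lam occurs, so c = 1. The obstacle
    to membership is that neither zeta_{2(p-1)} nor p^(1/(p(p-1))) lies in the field; only their
    product lam_2 does. In L coefficients do not add, because of carries; limits rest on the fact
    that v(a - b) >= r exactly when the coefficients of a and b agree below r. *)

Section MinSupport.
Variable k : nzRingType.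
Implicit Types f g : rat -> k.

Lemma min_supportE f x : is_least (support_of f) x -> min_support f = x%:E.
Proof.
move=> [fx lex]; rewrite /min_support; case: pselect => [e|]; last by case; exists x.
case: (cid e) => y [fy ley] /=; congr (_%:E).
by apply/eqP; rewrite eq_le ley //= lex.
Qed.

Lemma well_ordered_min f : well_ordered_support f ->
  f = (fun=> 0) \/ exists x, is_least (support_of f) x.
Proof.
move=> wf; have [[x fx]|nf] := pselect (exists x, f x != 0); last first.
  left; apply: funext => x; apply/eqP; apply: contraT => fx; case: nf; by exists x.
by right; apply: wf => //; exists x.
Qed.

Lemma min_support0 : min_support (fun=> 0 : k) = +oo%E.
Proof.
by rewrite /min_support; case: pselect => // -[x []]; rewrite /support_of /= eqxx.
Qed.

Lemma le_min_support f r : well_ordered_support f ->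
  (r%:E <= min_support f)%E <-> (forall x, x < r -> f x = 0).
Proof.
move=> /well_ordered_min [->|[x xl]]; first by rewrite min_support0 leey; split.
rewrite (min_supportE xl) lee_fin; case: xl => fx lex; split=> [le_rx y lt_yr|h].
  apply/eqP; apply: contraT => fy; have := lex y fy.
  by rewrite leNgt (lt_le_trans lt_yr).
by rewrite leNgt; apply/negP => /h fx0; move: fx; rewrite /support_of /= fx0 eqxx.
Qed.

Lemma well_ordered_sub f g : well_ordered_support f ->
  (forall x, g x != 0 -> f x != 0) -> well_ordered_support g.
Proof. by move=> wf gf A Ag; apply: wf => x /Ag; exact: gf. Qed.

Lemma well_ordered0 : well_ordered_support (fun=> 0 : k).
Proof. by move=> A A0 [x /A0]; rewrite /support_of /= eqxx. Qed.

Lemma well_ordered_monomial x c : well_ordered_support (monomial x c : rat -> k).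
Proof.
move=> A Ax [y Ay]; exists y; split=> // w Aw.
have mono u : A u -> u = x.
  by move=> /Ax; rewrite /support_of /= /monomial; case: (eqVneq u x) => // _; rewrite eqxx.
by rewrite (mono _ Ay) (mono _ Aw).
Qed.

End MinSupport.

Section Valuation.
Variables (p : nat) (L : malcevNeumann p).
Implicit Types (a b c : L) (r s x y : rat).

Definition vge r a : Prop := (r%:E <= vp a)%E.

Lemma hsum0 : hsum L (fun=> 0) = 0.
Proof.
have h := hsumD L (@well_ordered0 _) (@well_ordered0 _) (fun=> or_introl (erefl _)).
move: h; rewrite (_ : (fun=> 0 + 0) = (fun=> 0)); last by apply: funext => ?; rewrite addr0.
by move=> /(congr1 (fun t => t - hsum L (fun=> 0))); rewrite subrr addrK.
Qed.

Lemma coef0 : coef (0 : L) = (fun=> 0).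
Proof. by rewrite -hsum0 coef_hsum //; exact: well_ordered0. Qed.

Lemma coef_eq0 a : coef a = (fun=> 0) -> a = 0.
Proof. by move=> h; rewrite -(hsum_coef a) h hsum0. Qed.

Lemma vp0 : vp (0 : L) = +oo%E.
Proof. by rewrite /vp coef0 min_support0. Qed.

Lemma vp_fin a : a != 0 -> exists x, vp a = x%:E.
Proof.
move=> a0; case: (well_ordered_min (@coef_wo _ L a)) => [/coef_eq0 a0'|[x /min_supportE h]].
  by rewrite a0' eqxx in a0.
by exists x.
Qed.

Lemma vpM a b : vp (a * b) = (vp a + vp b)%E.
Proof. exact: mn_valM. Qed.

Lemma vp1 : vp (1 : L) = 0%:E.
Proof.
have [x vx] := vp_fin (oner_neq0 L).
have := vpM 1 1; rewrite mulr1 vx -EFinD => -[] h; congr (_%:E).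
by apply: (addrI x); rewrite addr0.
Qed.

Lemma vpM_fin a b x y : vp a = x%:E -> vp b = y%:E -> vp (a * b) = (x + y)%:E.
Proof. by move=> ha hb; rewrite vpM ha hb. Qed.

Lemma vp_neq0 a x : vp a = x%:E -> a != 0.
Proof. by move=> va; apply/eqP => a0; move: va; rewrite a0 vp0. Qed.

Lemma vpX_fin a x n : vp a = x%:E -> vp (a ^+ n) = (n%:R * x)%:E.
Proof.
move=> va; elim: n => [|n IH]; first by rewrite expr0 vp1 mul0r.
by rewrite exprS (vpM_fin va IH) -natr1 mulrDl mul1r addrC.
Qed.

Lemma vpV_fin a x : vp a = x%:E -> vp a^-1 = (- x)%:E.
Proof.
move=> va; have a0 := vp_neq0 va; have [y vy] := vp_fin (invr_neq0 a0).
have := vpM_fin va vy; rewrite divff // vp1 vy => -[] h; congr (_%:E).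
by apply: (addrI x); rewrite subrr.
Qed.

Lemma vp_root a n x : (0 < n)%N -> vp (a ^+ n) = x%:E -> vp a = (x / n%:R)%:E.
Proof.
move=> n0 van; have a0 : a != 0.
  by apply: contraTneq n0 => a0; move: van; rewrite a0 expr0n; case: n => //= n; rewrite vp0.
have [y vy] := vp_fin a0; move: van; rewrite (vpX_fin _ vy) vy => -[<-].
congr (_%:E); rewrite mulrAC divff ?mul1r // pnatr_eq0 -lt0n //.
Qed.

Lemma vpN a : vp (- a) = vp a.
Proof.
have v1 : vp (- 1 : L) = 0%:E.
  rewrite -(mul0r (2%:R)^-1); apply: (@vp_root _ 2) => //.
  by rewrite sqrrN expr1n vp1.
by rewrite -mulN1r vpM v1 add0e.
Qed.

Lemma vgeE a r : vge r a <-> forall x, x < r -> coef a x = 0.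
Proof. by apply: le_min_support; exact: coef_wo. Qed.

Lemma vge0 r : vge r (0 : L).
Proof. by rewrite /vge vp0 leey. Qed.

Lemma vge_fin r a x : vp a = x%:E -> r <= x -> vge r a.
Proof. by rewrite /vge => ->; rewrite lee_fin. Qed.

Lemma vge_le r s a : s <= r -> vge r a -> vge s a.
Proof. by move=> sr; apply: le_trans; rewrite lee_fin. Qed.

Lemma vgeN r a : vge r a -> vge r (- a).
Proof. by rewrite /vge vpN. Qed.

Lemma vgeD r a b : vge r a -> vge r b -> vge r (a + b).
Proof.
by move=> ha hb; apply: le_trans (mn_valD a b); rewrite le_min; apply/andP.
Qed.

Lemma vgeB r a b : vge r a -> vge r b -> vge r (a - b).
Proof. by move=> ha hb; apply: vgeD => //; exact: vgeN. Qed.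

Lemma vgeM r s a b : vge r a -> vge s b -> vge (r + s) (a * b).
Proof. by move=> ha hb; rewrite /vge vpM EFinD; exact: leeD. Qed.

Lemma vge1 : vge 0 (1 : L).
Proof. by rewrite /vge vp1. Qed.

Lemma vge_eq0 a : (forall r, vge r a) -> a = 0.
Proof.
move=> h; apply/eqP; apply: contraT => /vp_fin [x vx].
by have := h (x + 1); rewrite /vge vx lee_fin; lra.
Qed.

Lemma vge_sum r (I : Type) (l : seq I) (P : pred I) (F : I -> L) :
  (forall i, P i -> vge r (F i)) -> vge r (\sum_(i <- l | P i) F i).
Proof. by move=> h; elim/big_ind: _ => //; [exact: vge0 | move=> *; exact: vgeD]. Qed.

Lemma vp_dominant a b x : vp a = x%:E -> (x%:E < vp b)%E -> vp (a + b) = x%:E.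
Proof.
move=> va vb; apply/eqP; rewrite eq_le; apply/andP; split; last first.
  by apply: vgeD; rewrite /vge ?va // ltW.
rewrite leNgt; apply/negP => vab.
have : (x%:E < vp (a + b - b))%E.
  apply: lt_le_trans (mn_valD _ _); rewrite lt_min vab /=.
  by rewrite -/(vp (- b)) vpN.
by rewrite addrK va ltxx.
Qed.

Lemma vge_gt0 a : (0%:E < vp a)%E -> exists2 r, 0 < r & vge r a.
Proof.
have [->|/vp_fin [x vx]] := eqVneq a 0; first by exists 1 => //; exact: vge0.
by rewrite vx lte_fin => x0; exists x => //; rewrite /vge vx.
Qed.

Lemma gt0_vge a r : 0 < r -> vge r a -> (0%:E < vp a)%E.
Proof. by move=> r0; apply: lt_le_trans; rewrite lte_fin. Qed.

(** Additivity makes [ppow L 0] idempotent, so only the value 0 must be excluded: it would make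
    [hsum] of the monomial with coefficient 1 vanish, against [coef_hsum]. *)
Lemma ppow0 : ppow L 0 = 1.
Proof.
have h : ppow L 0 != 0.
  apply/eqP => p0; have h x : ppow L x = 0 by rewrite -(addr0 x) ppowD p0 mulr0.
  have : vp (1 : L) = +oo%E.
    rewrite /vp -(hsum_coef (1 : L)).
    have t1 : teich L 1 = 1 by exact: (teich_morph L).1.
    have e : hsum L (monomial 0 1) = 0 by rewrite hsum_monomial h mulr0.
    have := coef_hsum L (@well_ordered_monomial (Fpbar p) 0 1); rewrite e coef0.
    move=> /(congr1 (fun f => f 0)); rewrite /monomial eqxx => /esym/eqP.
    by rewrite oner_eq0.
  by rewrite vp1.
by apply: (mulfI h); rewrite -ppowD addr0 mulr1.
Qed.

Lemma ppow_neq0 x : ppow L x != 0.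
Proof.
apply/eqP => p0; have := ppowD L x (- x); rewrite subrr ppow0 p0 mul0r => /eqP.
by rewrite oner_eq0.
Qed.

Lemma ppowX x n : ppow L x ^+ n = ppow L (n%:R * x).
Proof.
elim: n => [|n IH]; first by rewrite expr0 mul0r ppow0.
by rewrite exprS IH -ppowD -natr1 mulrDl mul1r addrC.
Qed.

Lemma ppowN x : ppow L (- x) = (ppow L x)^-1.
Proof.
apply: (mulfI (ppow_neq0 x)); rewrite divff ?ppow_neq0 //.
by rewrite -ppowD subrr ppow0.
Qed.

Lemma teich0 : teich L 0 = 0.
Proof.
apply: (mulIf (ppow_neq0 0)); rewrite mul0r -hsum_monomial -hsum0; congr hsum.
by apply: funext => x; rewrite /monomial; case: eqP.
Qed.

Lemma teich1 : teich L 1 = 1. Proof. exact: (teich_morph L).1. Qed.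

Lemma teichM (c d : Fpbar p) : teich L (c * d) = teich L c * teich L d.
Proof. exact: (teich_morph L).2. Qed.

Lemma vp_monomial (c : Fpbar p) x : c != 0 -> vp (teich L c * ppow L x) = x%:E.
Proof.
move=> c0; rewrite /vp -hsum_monomial coef_hsum; last exact: well_ordered_monomial.
apply: min_supportE; split; first by rewrite /support_of /= /monomial eqxx.
by move=> y; rewrite /support_of /= /monomial; case: (eqVneq y x) => [->//|_]; rewrite eqxx.
Qed.

Lemma vp_ppow x : vp (ppow L x) = x%:E.
Proof. by rewrite -(mul1r (ppow L x)) -teich1 vp_monomial // oner_neq0. Qed.

Lemma vp_teich (c : Fpbar p) : c != 0 -> vp (teich L c) = 0%:E.
Proof. by move=> c0; rewrite -(vp_monomial 0 c0) ppow0 mulr1. Qed.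

Lemma vge_teich (c : Fpbar p) : vge 0 (teich L c).
Proof.
have [->|c0] := eqVneq c 0; first by rewrite teich0; exact: vge0.
by rewrite /vge vp_teich.
Qed.

(** Lifts are additive modulo positive valuation, so the difference is [teich L (c - d)] plus a term
    of positive valuation. *)
Lemma vp_teichB (c d : Fpbar p) : c != d -> vp (teich L c - teich L d) = 0%:E.
Proof.
move=> cd; have cd0 : c - d != 0 by rewrite subr_eq0.
have h := teichD L (c - d) d; rewrite subrK in h.
rewrite (_ : teich L c - teich L d =
   teich L (c - d) + (teich L c - teich L (c - d) - teich L d)); last by ring.
by rewrite (vp_dominant (vp_teich cd0)).
Qed.

Lemma vp_p : vp (p%:R : L) = 1%:E.
Proof. by rewrite -ppow1 vp_ppow. Qed.

(** * Truncations, coefficients and limits *)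

Definition trunc r a : L := hsum L (fun x => if x < r then coef a x else 0).

Lemma trunc_wo r a : well_ordered_support (fun x => if x < r then coef a x else 0).
Proof. by apply: well_ordered_sub (@coef_wo _ L a) _ => x; case: ifP => //; rewrite eqxx. Qed.

(** [hsum] adds up only disjoint supports; cutting the support of [a] at [r] produces two such
    pieces, and the upper one is the difference. *)
Lemma vge_trunc r a : vge r (a - trunc r a).
Proof.
have wo : well_ordered_support (fun x => if x < r then 0 else coef a x).
  by apply: well_ordered_sub (@coef_wo _ L a) _ => x; case: ifP => //; rewrite eqxx.
have disj x : (if x < r then coef a x else 0) = 0 \/ (if x < r then 0 else coef a x) = 0.
  by case: ifP => _; [right|left].
have := hsumD L (@trunc_wo r a) wo disj.
rewrite (_ : (fun x => _) = coef a); last first.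
  by apply: funext => x; case: ifP => _; rewrite ?addr0 ?add0r.
rewrite hsum_coef -/(trunc r a) => h.
rewrite (_ : a - _ = hsum L (fun x => if x < r then 0 else coef a x)); last first.
  by rewrite [X in X - _]h addrC addKr.
by apply/vgeE => x xr; rewrite coef_hsum // xr.
Qed.

Lemma vgeB_coef r a b : (forall x, x < r -> coef a x = coef b x) -> vge r (a - b).
Proof.
move=> h; rewrite (_ : a - b = (a - trunc r a) - (b - trunc r b)); last first.
  suff -> : trunc r a = trunc r b by ring.
  by congr hsum; apply: funext => x; case: ifP => // /h.
by apply: vgeB; exact: vge_trunc.
Qed.

(** Lets the least exponent where two expansions differ be chosen: such exponents lie in the union
    of two well-ordered supports, and the minima of both parts are compared. *)
Lemma well_ordered_coef2 a b (A : set rat) :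
  (forall x, A x -> coef a x != 0 \/ coef b x != 0) -> A !=set0 ->
  exists x, is_least A x.
Proof.
move=> hA [x Ax].
have least c (B : set rat) : B = A `&` [set x | coef c x != 0] ->
    B = set0 \/ exists x, is_least B x.
  move=> BE; have [B0|B0] := pselect (B !=set0); last first.
    by left; rewrite -subset0 => y By; apply: B0; exists y.
  by right; apply: (@coef_wo _ L c) => // y; rewrite BE => -[].
have [A0|[u [[Au cu] ul]]] := least a _ erefl;
  have [B0|[w [[Aw cw] wl]]] := least b _ erefl.
- have [ax|bx] := hA _ Ax.
    by have : (A `&` [set x | coef a x != 0]) x by []; rewrite A0.
  by have : (A `&` [set x | coef b x != 0]) x by []; rewrite B0.
- exists w; split=> // y Ay; case: (hA _ Ay) => cy; last exact: wl.
  by have : (A `&` [set x | coef a x != 0]) y by []; rewrite A0.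
- exists u; split=> // y Ay; case: (hA _ Ay) => cy; first exact: ul.
  by have : (A `&` [set x | coef b x != 0]) y by []; rewrite B0.
exists (Order.min u w); split.
  by case: (leP u w).
move=> y Ay; rewrite ge_min; case: (hA _ Ay) => cy; first by rewrite ul.
by rewrite wl ?orbT.
Qed.

(** Carries spoil coefficientwise subtraction, but not at the least exponent [y] of disagreement:
    the common part below [y] cancels, and at [y] two distinct Teichmueller lifts leave a difference
    of valuation 0 times p^y. Hence [a - b] has valuation [y]. *)
Lemma coef_vgeB r a b : vge r (a - b) -> forall x, x < r -> coef a x = coef b x.
Proof.
move=> hab x xr; apply/eqP; apply: contraT => neq.
have [|y [] /= ney yl] := @well_ordered_coef2 a b [set y | coef a y != coef b y] _ (ex_intro _ x neq).
  move=> y /= ne; have [a0|] := eqVneq (coef a y) 0; last by left.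
  by right; rewrite a0 eq_sym in ne.
have yr : y < r by apply: le_lt_trans xr; exact: yl.
have tab : trunc y a = trunc y b.
  congr hsum; apply: funext => u; case: ifP => // uy.
  by apply/eqP; apply: contraT => /yl; rewrite leNgt uy.
have head c : exists2 e, (y%:E < vp e)%E &
    c - trunc y c = teich L (coef c y) * ppow L y + e.
  pose g u := if y < u then coef c u else 0.
  have wog : well_ordered_support g.
    by apply: well_ordered_sub (@coef_wo _ L c) _ => u; rewrite /g; case: ifP => //; rewrite eqxx.
  have wom := @well_ordered_monomial (Fpbar p) y (coef c y).
  exists (hsum L g).
    rewrite /vp coef_hsum //; case: (well_ordered_min wog) => [->|[u ul]].
      by rewrite min_support0 ltry.
    rewrite (min_supportE ul) lte_fin; case: ul => + _; rewrite /support_of /g /=.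
    by case: ifP => //; rewrite eqxx.
  rewrite -hsum_monomial -hsumD //; last first.
    move=> u; rewrite /monomial /g; case: eqP => [->|]; last by left.
    by right; rewrite ltxx.
  have h u : (if u < y then coef c u else 0) = 0 \/ monomial y (coef c y) u + g u = 0.
    rewrite /monomial /g; case: ltgtP; rewrite ?addr0; by [right|left|].
  apply/eqP; rewrite subr_eq addrC -hsumD //; last 2 first.
  - exact: trunc_wo.
  - apply: well_ordered_sub (@coef_wo _ L c) _ => u; rewrite /monomial /g.
    by case: ltgtP => [|yu|->]; rewrite ?addr0 ?add0r ?eqxx.
  rewrite -[X in X == _]hsum_coef; apply/eqP; congr hsum; apply: funext => u.
  by rewrite /monomial /g; case: ltgtP => [|yu|->]; rewrite ?addr0 ?add0r.
have [e1 ve1 h1] := head a; have [e2 ve2 h2] := head b.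
have e : a - b = (teich L (coef a y) - teich L (coef b y)) * ppow L y + (e1 - e2).
  have -> : a - b = (a - trunc y a) - (b - trunc y b) by rewrite tab; ring.
  rewrite h1 h2; ring.
have v1 : vp ((teich L (coef a y) - teich L (coef b y)) * ppow L y) = y%:E.
  by rewrite (vpM_fin (vp_teichB ney) (vp_ppow _)) add0r.
have v2 : (y%:E < vp (e1 - e2))%E.
  by apply: lt_le_trans (mn_valD _ _); rewrite lt_min ve1 -/(vp (- e2)) vpN ve2.
move: hab; rewrite /vge e (vp_dominant v1 v2) lee_fin leNgt yr //.
Qed.

(** Coefficients below [n] are final from [u n] on, so the limit is assembled coefficient by
    coefficient. Its support is well-ordered since below any point it agrees with the support of a
    single member of the sequence. *)
Lemma mn_complete (u : nat -> L) :
  (forall n, vge n%:R (u n.+1 - u n)) ->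
  exists l, forall n, vge n%:R (u n - l).
Proof.
move=> hu.
have cauchy m n : (m <= n)%N -> vge m%:R (u n - u m).
  move=> /subnKC <-; elim: (n - m)%N => [|j IH]; first by rewrite addn0 subrr; exact: vge0.
  rewrite (_ : u _ - u m = (u (m + j).+1 - u (m + j)) + (u (m + j) - u m)); last first.
    by rewrite addnS; ring.
  apply: vgeD => //; apply: vge_le (hu _); rewrite ler_nat; exact: leq_addr.
pose N (x : rat) := (Num.truncn `|x|).+1.
have Nx x : x < (N x)%:R.
  by apply: le_lt_trans (ler_norm x) _; exact: truncnS_gt.
pose f x := coef (u (N x)) x.
have fE n x : x < n%:R -> f x = coef (u n) x.
  move=> xn; rewrite /f; case: (leqP (N x) n) => h.
    by apply: esym; apply: coef_vgeB (Nx x); exact: cauchy.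
  by apply: coef_vgeB xn; apply: cauchy; exact: ltnW.
have wof : well_ordered_support f.
  move=> A Af [x Ax].
  have [||y [[Ay yx] yl]] := @well_ordered_coef2 (u (N x)) (u (N x)) (A `&` [set y | y <= x]).
  - move=> y [Ay yx]; left; rewrite -fE; first exact: Af.
    exact: le_lt_trans yx (Nx x).
  - by exists x; split=> /=.
  exists y; split=> // w Aw; case: (leP w x) => [wx|/ltW]; first exact: yl.
  exact: le_trans.
exists (hsum L f) => n; apply: vgeB_coef => x xn.
by rewrite coef_hsum // (fE n).
Qed.

End Valuation.

(** * p-adic numbers *)

Section PAdic.
Variables (p : nat) (p_prime : prime p) (L : malcevNeumann p).
Implicit Types (a b c : L) (r s x y : rat).

Let p_gt0 : (0 < p)%N := prime_gt0 p_prime.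

Lemma Fpbar_natr_eq0 n : (n%:R == 0 :> Fpbar p) = (p %| n)%N.
Proof.
have [f _] := projT2 (countable_algebraic_closure 'F_p).
by rewrite -(rmorph_nat f) fmorph_eq0 (dvdn_pcharf (pchar_Fp p_prime)).
Qed.

Lemma vge_nat n : vge 0 (n%:R : L).
Proof.
elim: n => [|n IH]; first exact: vge0.
by rewrite -natr1; apply: vgeD => //; exact: vge1.
Qed.

Lemma vgeM0 r a b : vge 0 a -> vge r b -> vge r (a * b).
Proof. by move=> ha hb; rewrite -(add0r r); exact: vgeM. Qed.

Lemma vgeMr0 r a b : vge r a -> vge 0 b -> vge r (a * b).
Proof. by move=> ha hb; rewrite mulrC; exact: vgeM0. Qed.

Lemma vgeX0 a n : vge 0 a -> vge 0 (a ^+ n).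
Proof.
move=> ha; elim: n => [|n IH]; first exact: vge1.
by rewrite exprS; exact: vgeM0.
Qed.

Lemma natr_teich n : (0%:E < vp (n%:R - teich L n%:R))%E.
Proof.
elim: n => [|n IH]; first by rewrite teich0 subrr vp0 ltry.
have h := teichD L n%:R 1; rewrite natr1 teich1 in h.
rewrite (_ : _ - _ = (n%:R - teich L n%:R) - (teich L n.+1%:R - teich L n%:R - 1)); last first.
  by rewrite -[n.+1%:R in X in X - _]natr1; ring.
by apply: lt_le_trans (mn_valD _ _); rewrite lt_min IH -/(vp (- _)) vpN.
Qed.

Lemma vp_nat_coprime n : ~~ (p %| n)%N -> vp (n%:R : L) = 0%:E.
Proof.
rewrite -Fpbar_natr_eq0 => /(vp_teich L) v0.
by rewrite -[n%:R](subrK (teich L n%:R)) addrC (vp_dominant v0 (natr_teich n)).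
Qed.

Lemma vp_nat n : (0 < n)%N -> vp (n%:R : L) = (logn p n)%:R%:E.
Proof.
move=> n0; have [m cpm ->] := pfactor_coprime p_prime n0.
have m0 : (0 < m)%N by rewrite lt0n; apply: contraTneq cpm => ->; rewrite /coprime gcdn0 gtn_eqF // prime_gt1.
rewrite lognM ?expn_gt0 ?p_gt0 // pfactorK //.
rewrite (logn_coprime cpm) add0n.
rewrite natrM natrX (vpM_fin (vp_nat_coprime _) (vpX_fin _ (vp_p L))); last by rewrite -prime_coprime.
by rewrite add0r mulr1.
Qed.

Lemma mn_natr_neq0 n : (0 < n)%N -> n%:R != 0 :> L.
Proof. by move=> /vp_nat; exact: vp_neq0. Qed.

Lemma mn_intr_eq0 (n : int) : (n%:~R == 0 :> L) = (n == 0).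
Proof.
case: n => n.
  by case: n => [|n]; rewrite ?eqxx //; apply/negbTE; rewrite -pmulrn mn_natr_neq0.
by apply/negbTE; rewrite NegzE mulrNz oppr_eq0 -pmulrn mn_natr_neq0.
Qed.

Lemma vge_natV n : ~~ (p %| n)%N -> vge 0 (n%:R^-1 : L).
Proof. by move=> /vp_nat_coprime h; rewrite /vge (vpV_fin h) oppr0. Qed.

Lemma vge_ltV n : (0 < n < p)%N -> vge 0 (n%:R^-1 : L).
Proof. by move=> /andP[n0 np]; apply: vge_natV; rewrite gtnNdvd. Qed.

Lemma prime_ndvd_fact n : (n < p)%N -> ~~ (p %| n`!)%N.
Proof.
elim: n => [|n IH] np; first by rewrite dvdn1 gtn_eqF // prime_gt1.
by rewrite factS Euclid_dvdM // negb_or gtnNdvd // IH // ltnW.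
Qed.

Lemma vge_factV n : (n < p)%N -> vge 0 (n`!%:R^-1 : L).
Proof. by move=> np; apply: vge_natV; exact: prime_ndvd_fact. Qed.

Lemma mn_fact_neq0 n : n`!%:R != 0 :> L.
Proof. by apply: mn_natr_neq0; exact: fact_gt0. Qed.

(** The inner binomial coefficients are divisible by [p] and their terms by [a * b]. The explicit
    factor [a * b] is what makes the gain in [vge_exprp_sub] possible. *)
Lemma exprDp a b : vge 0 a -> vge 0 b ->
  exists2 w, vge 0 w & (a + b) ^+ p = a ^+ p + b ^+ p + p%:R * (a * b) * w.
Proof.
move=> ha hb; exists (\sum_(1 <= i < p) ('C(p, i) %/ p)%:R * (a ^+ (p - i).-1 * b ^+ i.-1)).
  rewrite big_nat_cond; apply: vge_sum => i _.
  by apply: vgeM0; [exact: vge_nat | apply: vgeM0; exact: vgeX0].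
rewrite exprDn -(big_mkord xpredT (fun i => a ^+ (p - i) * b ^+ i *+ 'C(p, i))).
rewrite big_nat_recr //= big_ltn // subnn subn0 bin0 binn !expr0 mulr1 mul1r !mulr1n.
rewrite -addrA [X in _ + X]addrC addrA; congr (_ + _).
rewrite big_distrr /= !big_nat; apply: eq_bigr => i /andP[i0 ip].
have /divnK e : (p %| 'C(p, i))%N by apply: prime_dvd_bin => //; rewrite i0.
rewrite -mulr_natr -{1}e natrM.
have -> : a ^+ (p - i) = a * a ^+ (p - i).-1 by rewrite -exprS prednK // subn_gt0.
have -> : b ^+ i = b * b ^+ i.-1 by rewrite -exprS prednK.
ring.
Qed.

(** With [h = a - b], the difference is [h ^+ p] plus [p h] times an integral element. Both gain at
    least [r]: the first contains [h ^+ 2], and in the second [p] has valuation 1 >= [r]. *)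
Lemma vge_exprp_sub a b r j : vge 0 a -> vge 0 b -> 0 <= r <= 1 ->
  vge (j.+1%:R * r) (a - b) -> vge (j.+2%:R * r) (a ^+ p - b ^+ p).
Proof.
move=> ha hb /andP[r0 r1] hab; have h0 : vge 0 (a - b) by exact: vgeB.
have [w hw e] := exprDp hb h0; rewrite addrC subrK in e.
rewrite e (_ : _ - _ = (a - b) ^+ p + p%:R * (a - b) * (b * w)); last by ring.
apply: vgeD.
  have -> : (a - b) ^+ p = (a - b) * (a - b) * (a - b) ^+ (p - 2).
    by rewrite -expr2 -exprD subnKC // prime_gt1.
  apply: vgeMr0; last exact: vgeX0.
  by apply: vge_le (vgeM hab hab); have := ler0n rat j; rewrite -!natr1; nra.
apply: vgeMr0; last exact: vgeM0.
apply: vge_le (vgeM _ hab); last by rewrite /vge vp_p.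
by have := ler0n rat j; rewrite -!natr1; nra.
Qed.

Lemma vge_exprpn_sub a b r n : vge 0 a -> vge 0 b -> 0 <= r <= 1 ->
  vge r (a - b) -> vge (n.+1%:R * r) (a ^+ (p ^ n) - b ^+ (p ^ n)).
Proof.
move=> ha hb hr hab; elim: n => [|n IH]; first by rewrite !expr1 mul1r.
by rewrite expnSr !exprM; apply: vge_exprp_sub => //; exact: vgeX0.
Qed.

(** Frobenius is the identity on the image of ['F_p], and [teich] is multiplicative. *)
Lemma teich_natX n k : teich L n%:R ^+ (p ^ k) = teich L n%:R.
Proof.
have tX (c : Fpbar p) m : teich L c ^+ m = teich L (c ^+ m).
  by elim: m => [|m IH]; rewrite ?expr0 ?teich1 // !exprS teichM IH.
elim: k => [|k IH]; first by rewrite expr1.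
rewrite expnSr exprM IH tX; congr teich.
rewrite -natrX; have [f _] := projT2 (countable_algebraic_closure 'F_p).
rewrite -!(rmorph_nat f); congr (f _).
rewrite natrX; set x : 'F_p := n%:R.
have := expf_card x; by rewrite card_Fp.
Qed.

(** Positive valuation is improved to 1 by taking [p ^ k]-th powers: these leave the Teichmueller
    lift fixed, change [n] only by a multiple of [p] (Fermat), and raise the valuation of the
    difference past 1. *)
Lemma natr_teich_vge1 n : vge 1 (n%:R - teich L n%:R).
Proof.
have [r r0 hr] := vge_gt0 (natr_teich n).
pose s := Order.min r 1.
have hs : vge s (n%:R - teich L n%:R).
  by apply: vge_le hr; rewrite /s ge_min lexx.
have s01 : 0 <= s <= 1 by rewrite /s; case: (leP r 1) => ?; apply/andP; split; lra.
have s0 : 0 < s by rewrite /s lt_min r0 ltr01.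
have [k hk] : exists k : nat, 1 <= k.+1%:R * s.
  exists (Num.truncn s^-1); rewrite -ler_pdivrMr // mul1r ltW //.
  exact: truncnS_gt.
have h := vge_exprpn_sub k (vge_nat n) (vge_teich L n%:R) s01 hs.
rewrite teich_natX in h.
rewrite (_ : _ - _ = (n%:R - n%:R ^+ (p ^ k)) + (n%:R ^+ (p ^ k) - teich L n%:R)); last by ring.
apply: vgeD; last exact: vge_le h.
have fermat : (p %| n ^ (p ^ k) - n)%N.
  have e : n ^ (p ^ k) = n %[mod p].
    elim: {h hk} k => [|k IH]; first by rewrite expn1.
    by rewrite expnSr expnM -modnXm IH modnXm fermat_little.
  have [le|lt] := leqP n (n ^ (p ^ k)); last by rewrite (eqP (ltnW lt)) dvdn0.
  by rewrite -eqn_mod_dvd //; apply/eqP.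
have le : (n <= n ^ (p ^ k))%N.
  case: n {hr hs h fermat} => // n; rewrite -{1}(expn1 n.+1) leq_pexp2l // expn_gt0 p_gt0 //.
rewrite -[n%:R - _]opprB; apply: vgeN; rewrite -natrX -natrB //.
have /dvdnP [m ->] := fermat; rewrite natrM; apply: vgeM0; first exact: vge_nat.
by rewrite /vge vp_p.
Qed.

(** The laws of [ratr] in [L] come from characteristic 0, which the finite valuation of nonzero
    integers provides; writing rationals as integer quotients turns these laws into identities for
    [field]. *)
Lemma ratr_div (n d : int) : d != 0 -> ratr (n%:~R / d%:~R) = n%:~R / d%:~R :> L.
Proof.
move=> d0; rewrite /ratr; set q := n%:~R / d%:~R.
have e : numq q * d = n * denq q.
  have qd : q * d%:~R = n%:~R by rewrite /q divfK // intr_eq0.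
  by apply: (@intr_inj rat); rewrite !rmorphM /= numqE mulrAC qd.
apply/eqP; rewrite eqr_div ?mn_intr_eq0 ?denq_neq0 //.
by rewrite -!rmorphM /= e.
Qed.

Lemma ratr_fracE (q : rat) : exists2 nd : int * int, nd.2 != 0 &
  q = nd.1%:~R / nd.2%:~R.
Proof. by exists (numq q, denq q); [exact: denq_neq0 | rewrite divq_num_den]. Qed.

Lemma mn_ratrB (x y : rat) : ratr (x - y) = ratr x - ratr y :> L.
Proof.
have [[n d] /= d0 ->] := ratr_fracE x; have [[m e] /= e0 ->] := ratr_fracE y.
have de0 : d * e != 0 by rewrite mulf_neq0.
have -> : n%:~R / d%:~R - m%:~R / e%:~R = (n * e - m * d)%:~R / (d * e)%:~R :> rat.
  by rewrite rmorphB !rmorphM /=; field; rewrite !intr_eq0 d0 e0.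
by rewrite !ratr_div // rmorphB !rmorphM /=; field; rewrite !mn_intr_eq0 d0 e0.
Qed.

Lemma mn_ratrM (x y : rat) : ratr (x * y) = ratr x * ratr y :> L.
Proof.
have [[n d] /= d0 ->] := ratr_fracE x; have [[m e] /= e0 ->] := ratr_fracE y.
have de0 : d * e != 0 by rewrite mulf_neq0.
have -> : n%:~R / d%:~R * (m%:~R / e%:~R) = (n * m)%:~R / (d * e)%:~R :> rat.
  by rewrite !rmorphM /=; field; rewrite !intr_eq0 d0 e0.
by rewrite !ratr_div // !rmorphM /=; field; rewrite !mn_intr_eq0 d0 e0.
Qed.

Lemma mn_ratrV (x : rat) : ratr x^-1 = (ratr x)^-1 :> L.
Proof.
have [[n d] /= d0 ->] := ratr_fracE x.
have [->|n0] := eqVneq n 0.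
  have /= e0 := ratr_div 0 (oner_neq0 int); rewrite !mul0r in e0.
  by rewrite !mul0r !invr0 e0 invr0.
by rewrite invf_div !ratr_div // invf_div.
Qed.

Lemma mn_ratr_nat n : ratr n%:R = n%:R :> L.
Proof.
by have := ratr_div n (oner_neq0 int); rewrite !divr1.
Qed.

Lemma vp_ratr (q : rat) : q != 0 -> exists k : int, vp (ratr q : L) = k%:~R%:E.
Proof.
have vint (n : int) : n != 0 -> exists k : int, vp (n%:~R : L) = k%:~R%:E.
  case: n => n n0; first by exists (logn p n); rewrite -pmulrn vp_nat // lt0n.
  exists (logn p n.+1); by rewrite NegzE mulrNz vpN -pmulrn vp_nat.
move=> q0; have [[n d] /= d0 qE] := ratr_fracE q.
have n0 : n != 0 by apply: contraNneq q0 => n0; rewrite qE n0 mul0r.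
have [k hk] := vint n n0; have [l hl] := vint d d0.
exists (k - l); rewrite qE ratr_div // (vpM_fin hk (vpV_fin hl)).
by rewrite rmorphB.
Qed.

Lemma Qp_ratr (q : rat) : Qp (ratr q : L).
Proof. by move=> r; exists q; rewrite /eq_bigO subrr; exact: vge0. Qed.

Lemma Qp_nat n : Qp (n%:R : L).
Proof. by rewrite -mn_ratr_nat; exact: Qp_ratr. Qed.

Lemma Qp_closed a : (forall r, exists2 b, Qp b & vge r (a - b)) -> Qp a.
Proof.
move=> h r; have [b hb hab] := h r; have [q hq] := hb r; exists q.
by rewrite /eq_bigO -(subrK b a) -addrA; exact: vgeD.
Qed.

(** A rational number closer to [a] than the size of [a] has the same valuation. *)
Lemma vp_Qp a : Qp a -> a != 0 -> exists k : int, vp a = k%:~R%:E.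
Proof.
move=> ha /vp_fin [x vx]; have [q hq] := ha (x + 1).
have lt : (x%:E < vp (ratr q - a : L))%E.
  by rewrite -vpN opprB; apply: lt_le_trans hq; rewrite lte_fin; lra.
have vq := vp_dominant vx lt; rewrite addrC subrK in vq.
have q0 : q != 0.
  by apply/eqP => q0; move: vq; rewrite q0 (mn_ratr_nat 0) vp0.
by have [k hk] := vp_ratr q0; exists k; rewrite vx -vq.
Qed.

Lemma QpB a b : Qp a -> Qp b -> Qp (a - b).
Proof.
move=> ha hb r; have [x hx] := ha r; have [y hy] := hb r; exists (x - y).
rewrite /eq_bigO mn_ratrB (_ : _ - _ = (a - ratr x) - (b - ratr y)); last by ring.
exact: vgeB.
Qed.

Lemma Qp_vge a : Qp a -> exists r, vge r a.
Proof.
have [->|/vp_fin [x vx] _] := eqVneq a 0; first by exists 0; exact: vge0.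
by exists x; rewrite /vge vx.
Qed.

Lemma QpM a b : Qp a -> Qp b -> Qp (a * b).
Proof.
move=> ha hb r; have [ra hra] := Qp_vge ha.
have [y hy] := hb (r - ra).
have [ry hry] := Qp_vge (Qp_ratr y).
have [x hx] := ha (r - ry); exists (x * y).
rewrite /eq_bigO mn_ratrM (_ : _ - _ = a * (b - ratr y) + (a - ratr x) * ratr y); last by ring.
apply: vgeD; first by have := vgeM hra hy; rewrite addrC subrK.
by have := vgeM hx hry; rewrite subrK.
Qed.

Lemma QpV a : Qp a -> Qp a^-1.
Proof.
have [->|a0] := eqVneq a 0; first by rewrite invr0.
move=> ha r; have [x vx] := vp_fin a0.
(* The bound [x + 1] gives the approximation the valuation of [a]; the bound [r + x + x] pays for
   the denominator in 1/a - 1/q = - (a - q) / (a q). *)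
have [q hq] := ha (Order.max (x + 1) (r + x + x)).
have lt : (x%:E < vp (ratr q - a : L))%E.
  rewrite -vpN opprB; apply: lt_le_trans hq; rewrite lte_fin lt_max.
  by apply/orP; left; lra.
have vq := vp_dominant vx lt; rewrite addrC subrK in vq.
have q0 := vp_neq0 vq.
exists q^-1; rewrite /eq_bigO mn_ratrV.
rewrite (_ : _ - _ = - (a - ratr q) * (a^-1 * (ratr q)^-1)); last by field; rewrite a0 q0.
have h1 : vge (r + x + x) (- (a - ratr q)).
  by apply: vgeN; apply: vge_le hq; rewrite le_max lexx orbT.
have h2 := vpM_fin (vpV_fin vx) (vpV_fin vq).
have := vgeM h1 (vge_fin h2 (lexx _)); congr vge; ring.
Qed.

(** The Teichmueller lift is the limit of the integers [n ^ (p ^ k)]. *)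
Lemma Qp_teich_nat n : Qp (teich L n%:R).
Proof.
apply: Qp_closed => r; exists (n%:R ^+ (p ^ Num.truncn `|r|)); first by rewrite -natrX; exact: Qp_nat.
rewrite -[X in vge _ X]opprB; apply: vgeN.
have := vge_exprpn_sub (Num.truncn `|r|) (vge_nat n) (vge_teich L n%:R) _ (natr_teich_vge1 n).
rewrite teich_natX mulr1 ler01 lexx => /(_ isT); apply: vge_le.
by apply: le_trans (ler_norm r) _; apply: ltW; exact: truncnS_gt.
Qed.

End PAdic.

(** * Linear algebra over Q_p *)

Section Subfield.
Variables (p : nat) (L : malcevNeumann p) (F : set L).
Hypothesis F_field : is_subfield F.
Implicit Types a b : L.

Lemma subfield1 : F 1. Proof. by case: F_field. Qed.
Lemma subfieldB a b : F a -> F b -> F (a - b). Proof. by case: F_field => _ h _; exact: h. Qed.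
Lemma subfield_div a b : F a -> F b -> F (a / b). Proof. by case: F_field => _ _ h; exact: h. Qed.
Lemma subfield0 : F 0. Proof. by rewrite -(subrr 1); apply: subfieldB; exact: subfield1. Qed.
Lemma subfieldN a : F a -> F (- a).
Proof. by move=> ?; rewrite -sub0r; apply: subfieldB => //; exact: subfield0. Qed.
Lemma subfieldD a b : F a -> F b -> F (a + b).
Proof. by move=> ? ?; rewrite -[b]opprK; apply: subfieldB => //; exact: subfieldN. Qed.
Lemma subfieldV a : F a -> F a^-1.
Proof. by move=> ?; rewrite -div1r; apply: subfield_div => //; exact: subfield1. Qed.
Lemma subfieldM a b : F a -> F b -> F (a * b).
Proof. by move=> ? ?; rewrite -[b]invrK; apply: subfield_div => //; exact: subfieldV. Qed.
Lemma subfieldX a n : F a -> F (a ^+ n).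
Proof.
move=> Fa; elim: n => [|n IH]; first exact: subfield1.
by rewrite exprS; exact: subfieldM.
Qed.
Lemma subfield_sum (I : Type) (l : seq I) (P : pred I) (f : I -> L) :
  (forall i, P i -> F (f i)) -> F (\sum_(i <- l | P i) f i).
Proof. by move=> h; elim/big_ind: _ => //; [exact: subfield0 | exact: subfieldD]. Qed.
Lemma subfield_nat n : F n%:R.
Proof.
elim: n => [|n IH]; first exact: subfield0.
by rewrite -natr1; apply: subfieldD => //; exact: subfield1.
Qed.

(** Gaussian elimination, written out because [F] is a set inside [L] and not a field type. If the
    first column vanishes, one row is dropped; otherwise the pivot row [i0] clears that column and
    its coefficient is recovered at the end. *)
Lemma subfield_dependence n (A : 'I_n.+1 -> 'I_n -> L) :
  (forall i j, F (A i j)) ->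
  exists c : 'I_n.+1 -> L, [/\ forall i, F (c i), exists i, c i != 0
    & forall j, \sum_i c i * A i j = 0].
Proof.
elim: n A => [|n IH] A FA.
  exists (fun=> 1); split=> [_||[]//]; first exact: subfield1.
  by exists ord0; rewrite oner_neq0.
have [/existsP [i0 Ai0]|/existsPn A0] := boolP [exists i, A i ord0 != 0]; last first.
  have [|c [Fc [i ci] sc]] := IH (fun i j => A (lift ord0 i) (lift ord0 j)); first by [].
  exists (fun i => if unlift ord0 i is Some i' then c i' else 0); split.
  - by move=> k; case: (unlift _ _) => [k'|] //; exact: subfield0.
  - by exists (lift ord0 i); rewrite liftK.
  move=> j; rewrite big_ord_recl unlift_none mul0r add0r.
  under eq_bigr do rewrite liftK.
  case: (unliftP ord0 j) => [j' ->|->]; first exact: sc.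
  by rewrite big1 // => k _; have := A0 (lift ord0 k); rewrite negbK => /eqP ->; rewrite mulr0.
pose q i := A (lift i0 i) ord0 / A i0 ord0.
have Fq i : F (q i) by exact: subfield_div.
have [|c [Fc [i ci] sc]] := IH (fun i j => A (lift i0 i) (lift ord0 j) - q i * A i0 (lift ord0 j)).
  by move=> i j; apply: subfieldB => //; exact: subfieldM.
exists (fun i => if unlift i0 i is Some i' then c i' else - \sum_k c k * q k); split.
- move=> k; case: (unlift _ _) => [k'|] //; apply: subfieldN; apply: subfield_sum => l _.
  exact: subfieldM.
- by exists (lift i0 i); rewrite liftK.
move=> j; rewrite (bigD1_ord i0) //= unlift_none.
under [X in _ + X]eq_bigr do rewrite liftK.
rewrite mulNr mulr_suml addrC -sumrB.
case: (unliftP ord0 j) => [j' ->|->]; last first.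
  by rewrite big1 // => k _; rewrite /q -mulrA divfK // subrr.
by rewrite -[RHS](sc j'); apply: eq_bigr => k _; ring.
Qed.

Section Span.
Variables (I : finType) (g : I -> L).

Definition lspan : set L :=
  [set y | exists2 c : I -> L, (forall i, F (c i)) & y = \sum_i c i * g i].

Lemma lspan0 : lspan 0.
Proof.
exists (fun=> 0) => [_|]; first exact: subfield0.
by rewrite big1 // => i _; rewrite mul0r.
Qed.

Lemma lspanD a b : lspan a -> lspan b -> lspan (a + b).
Proof.
move=> [c Fc ->] [d Fd ->]; exists (fun i => c i + d i) => [i|]; first exact: subfieldD.
by rewrite -big_split; apply: eq_bigr => i _; rewrite mulrDl.
Qed.

Lemma lspanZ x a : F x -> lspan a -> lspan (x * a).
Proof.
move=> Fx [c Fc ->]; exists (fun i => x * c i) => [i|]; first exact: subfieldM.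
by rewrite mulr_sumr; apply: eq_bigr => i _; rewrite mulrA.
Qed.

Lemma lspan_gen i : lspan (g i).
Proof.
exists (fun j => (i == j)%:R) => [j|]; first exact: subfield_nat.
rewrite (bigD1 i) //= eqxx mul1r big1 ?addr0 // => j ji.
by rewrite eq_sym (negbTE ji) mul0r.
Qed.

Lemma lspan_sum (J : Type) (l : seq J) (P : pred J) (f : J -> L) :
  (forall i, P i -> lspan (f i)) -> lspan (\sum_(i <- l | P i) f i).
Proof. by move=> h; elim/big_ind: _ => //; [exact: lspan0 | exact: lspanD]. Qed.

Lemma lspan_mull x a : (forall i, lspan (x * g i)) -> lspan a -> lspan (x * a).
Proof.
move=> h [c Fc ->]; rewrite mulr_sumr; apply: lspan_sum => i _.
by rewrite mulrCA; exact: lspanZ.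
Qed.

Lemma lspan_dependence (y : 'I_#|I|.+1 -> L) : (forall i, lspan (y i)) ->
  exists c : 'I_#|I|.+1 -> L, [/\ forall i, F (c i), exists i, c i != 0
    & \sum_i c i * y i = 0].
Proof.
move=> sy; pose A i (k : 'I_#|I|) := sval (cid2 (sy i)) (enum_val k).
have [|c [Fc c0 sc]] := @subfield_dependence _ A.
  by move=> i j; rewrite /A; case: (cid2 _).
exists c; split=> //.
have yE i : y i = \sum_k A i k * g (enum_val k).
  rewrite /A; case: (cid2 _) => /= d _ ->.
  by rewrite (reindex (@enum_val I I)) /=; [by [] | apply: onW_bij; exact: enum_val_bij].
under eq_bigr do rewrite yE mulr_sumr.
rewrite exchange_big /= big1 // => k _.
by under eq_bigr do rewrite mulrA; rewrite -mulr_suml sc mul0r.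
Qed.

(** Only inverses need an argument. The [#|I|.+1] powers of [a] are dependent; dividing a relation
    by its lowest nonzero term, and by [a], writes [a^-1] as a polynomial in [a]. *)
Lemma lspan_subfield : lspan 1 -> (forall a b, lspan a -> lspan b -> lspan (a * b)) ->
  is_subfield lspan.
Proof.
move=> s1 sM.
have sN a : lspan a -> lspan (- a).
  by move=> sa; rewrite -mulN1r; apply: lspanZ => //; apply: subfieldN; exact: subfield1.
have sX a n : lspan a -> lspan (a ^+ n).
  by move=> sa; elim: n => // n IH; rewrite exprS; exact: sM.
suff sV a : lspan a -> lspan a^-1.
  split=> // a b sa sb; last by apply: sM => //; exact: sV.
  by apply: lspanD => //; exact: sN.
have [->|a0] := eqVneq a 0; first by rewrite invr0.
move=> sa; have [|c [Fc [i0 ci0] sc]] := @lspan_dependence (fun i => a ^+ i).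
  by move=> i; exact: sX.
have [i ci mini] : exists2 i, c i != 0 & forall j : 'I__, (j < i)%N -> c j = 0.
  case: (@arg_minnP _ i0 [pred i | c i != 0] (@nat_of_ord _) ci0) => i ci mini.
  exists i => // j ji; apply/eqP; apply: contraT => cj.
  by have := mini j cj; rewrite leqNgt ji.
have e : a^-1 = - \sum_(j : 'I_#|I|.+1 | (i < j)%N) c j / c i * a ^+ (j - i).-1.
  apply: (mulfI (expf_neq0 i.+1 a0)); apply: (mulfI ci).
  have -> : c i * (a ^+ i.+1 * a^-1) = c i * a ^+ i by rewrite exprSr -mulrA divff // mulr1.
  rewrite -[LHS]addr0 -[X in _ + X = _]oppr0 -[in LHS]sc (bigD1 i) //=.
  rewrite opprD addNKr !mulrN; congr (- _); rewrite !mulr_sumr.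
  rewrite [in LHS](bigID (fun j : 'I__ => (i < j)%N)) /= [X in _ + X]big1 ?addr0; last first.
    move=> j /andP[ji]; rewrite -leqNgt leq_eqVlt -(inj_eq val_inj) in ji *.
    by rewrite (negbTE ji) /= => /mini ->; rewrite mul0r.
  apply: eq_big => [j|j ij].
    by rewrite andbC; case: ltngtP => //= ij; rewrite -(inj_eq val_inj) /= gtn_eqF.
  have -> : a ^+ j = a ^+ i.+1 * a ^+ (j - i).-1.
    by move: ij => /andP[_ ij]; rewrite -exprD addSnnS prednK ?subn_gt0 // subnKC // ltnW.
  by field.
rewrite e; apply: sN; apply: lspan_sum => j _; apply: lspanZ; first exact: subfield_div.
exact: sX.
Qed.

End Span.

(** * Extensions generated by two algebraic elements *)

Section Span2.
Variables (x y : L) (d e : nat).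
Definition monom2 (k : 'I_d * 'I_e) : L := x ^+ k.1 * y ^+ k.2.
Hypotheses (d0 : (0 < d)%N) (e0 : (0 < e)%N).
Hypothesis xd : exists2 c : 'I_d -> L, (forall i, F (c i)) & x ^+ d = \sum_i c i * x ^+ i.
Hypothesis ye : exists2 c : 'I_e -> L, (forall i, F (c i)) & y ^+ e = \sum_i c i * y ^+ i.

Let V := lspan monom2.

Lemma lspan2_gen i j : (i < d)%N -> (j < e)%N -> V (x ^+ i * y ^+ j).
Proof. by move=> id je; exact: (lspan_gen monom2 (Ordinal id, Ordinal je)). Qed.

Lemma lspan2_mulx a : V a -> V (x * a).
Proof.
apply: lspan_mull => -[i j]; rewrite /monom2 /= mulrA -exprS.
have [id|di] := ltnP i.+1 d; first exact: lspan2_gen.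
have <- : d = i.+1 by apply/eqP; rewrite eqn_leq di ltn_ord.
have [c Fc ->] := xd; rewrite mulr_suml; apply: lspan_sum => k _.
by rewrite -mulrA; apply: lspanZ => //; exact: lspan2_gen.
Qed.

Lemma lspan2_muly a : V a -> V (y * a).
Proof.
apply: lspan_mull => -[i j]; rewrite /monom2 /= mulrCA -exprS.
have [je|ej] := ltnP j.+1 e; first exact: lspan2_gen.
have <- : e = j.+1 by apply/eqP; rewrite eqn_leq ej ltn_ord.
have [c Fc ->] := ye; rewrite mulr_sumr; apply: lspan_sum => k _.
by rewrite mulrCA; apply: lspanZ => //; exact: lspan2_gen.
Qed.

Lemma lspan2M a b : V a -> V b -> V (a * b).
Proof.
move=> [c Fc ->] Vb; rewrite mulr_suml; apply: lspan_sum => -[i j] _.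
rewrite -mulrA; apply: lspanZ => //; rewrite /monom2 /= -mulrA.
have hy n a' : V a' -> V (y ^+ n * a').
  by elim: n => [|n IH] Va; rewrite ?mul1r // exprS -mulrA; apply: lspan2_muly; exact: IH.
have hx n a' : V a' -> V (x ^+ n * a').
  by elim: n => [|n IH] Va; rewrite ?mul1r // exprS -mulrA; apply: lspan2_mulx; exact: IH.
by apply: hx; exact: hy.
Qed.

Lemma lspan2_F a : F a -> V a.
Proof.
move=> Fa; rewrite -[a]mulr1 -[1]mulr1; apply: lspanZ => //.
exact: (@lspan2_gen 0 0).
Qed.

Lemma lspan2_x : V x.
Proof. by rewrite -[x]mulr1; apply: lspan2_mulx; apply: lspan2_F; exact: subfield1. Qed.

Lemma lspan2_y : V y.
Proof. by rewrite -[y]mulr1; apply: lspan2_muly; apply: lspan2_F; exact: subfield1. Qed.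

Lemma lspan2_subfield : is_subfield V.
Proof. by apply: lspan_subfield; [apply: lspan2_F; exact: subfield1 | exact: lspan2M]. Qed.

End Span2.
End Subfield.

Lemma ltn_eq_mod_int (i j n : nat) (k : int) : (i < n)%N -> (j < n)%N ->
  (i : int) - (j : int) = k * n -> i = j.
Proof.
move=> hi hj e.
have [k0|[k1|k1]] : k = 0 \/ (1 <= k) \/ (k <= -1) by lia.
- by rewrite k0 mul0r in e; lia.
- have : (n : int) <= k * n by rewrite -{1}[n : int]mul1r ler_pM2r //; lia.
  lia.
- have : k * n <= - (n : int) by rewrite -[- (n : int)]mulN1r ler_pM2r //; lia.
  lia.
Qed.

(** * Independence over Q_p from valuations modulo Z *)

Section DistinctValuations.
Variables (p : nat) (p_prime : prime p) (L : malcevNeumann p).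
Implicit Types (a b c : L) (r s x y : rat).

Lemma vgt_sum x (I : Type) (l : seq I) (P : pred I) (f : I -> L) :
  (forall i, P i -> (x%:E < vp (f i))%E) -> (x%:E < vp (\sum_(i <- l | P i) f i)%R)%E.
Proof.
move=> h; elim/big_ind: _ => //; first by rewrite vp0 ltry.
by move=> a b ha hb; apply: lt_le_trans (mn_valD _ _); rewrite lt_min ha hb.
Qed.

(** A term of least valuation dominates the sum, so no term can lie below [r]. The hypothesis
    exempts zero terms, which all share the valuation +oo. *)
Lemma vge_sum_distinct r (I : finType) (a : I -> L) :
  (forall i j, i != j -> a i != 0 -> vp (a i) != vp (a j)) ->
  vge r (\sum_i a i) -> forall i, vge r (a i).
Proof.
move=> dist hs i; rewrite /vge leNgt; apply/negP => lti.
case: (@arg_minP _ _ _ i predT (fun i => vp (a i)) isT) => j _ minj.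
have ltj : (vp (a j) < r%:E)%E by apply: le_lt_trans lti; exact: minj.
have aj0 : a j != 0 by apply/eqP => aj; move: ltj; rewrite aj vp0 ltNge leey.
have [x vx] := vp_fin aj0.
have h : (x%:E < vp (\sum_(k | k != j) a k)%R)%E.
  apply: vgt_sum => k kj; rewrite lt_neqAle -vx minj // andbT.
  by apply: dist => //; rewrite eq_sym.
by move: hs; rewrite (bigD1 j) //= /vge (vp_dominant vx h) -vx leNgt ltj.
Qed.

Lemma Qp_subfield : is_subfield (@Qp p L).
Proof.
split; first exact: (Qp_nat p_prime L 1).
  exact: QpB.
by move=> a b ha hb; apply: QpM => //; exact: QpV.
Qed.

Definition distinct_mod_int (I : Type) (x : I -> rat) :=
  forall i j, i <> j -> forall k : int, x i - x j <> k%:~R.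

(** Coefficients in [Qp] move valuations by integers only, so the nonzero terms keep distinct
    valuations. *)
Lemma vge_Qp_sum r (I : finType) (c g : I -> L) (x : I -> rat) :
  distinct_mod_int x -> (forall i, vp (g i) = (x i)%:E) -> (forall i, Qp (c i)) ->
  vge r (\sum_i c i * g i) -> forall i, vge r (c i * g i).
Proof.
move=> dist vg Qc; apply: vge_sum_distinct => i j ij cg0.
have ci0 : c i != 0 by apply: contraNneq cg0 => ->; rewrite mul0r.
have [k hk] := vp_Qp p_prime (Qc i) ci0.
rewrite (vpM_fin hk (vg i)); have [cj0|cj0] := eqVneq (c j) 0; first by rewrite cj0 mul0r vp0.
have [l hl] := vp_Qp p_prime (Qc j) cj0; rewrite (vpM_fin hl (vg j)).
apply/eqP => -[] e; apply: (dist i j _ (l - k)); first by apply/eqP.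
by rewrite rmorphB /=; lra.
Qed.

Lemma Qp_free (I : finType) (c g : I -> L) (x : I -> rat) :
  distinct_mod_int x -> (forall i, vp (g i) = (x i)%:E) -> (forall i, Qp (c i)) ->
  \sum_i c i * g i = 0 -> forall i, c i = 0.
Proof.
move=> dist vg Qc s0 i; have : c i * g i = 0.
  by apply: vge_eq0 => r; apply: (vge_Qp_sum dist vg Qc); rewrite s0; exact: vge0.
by move/eqP; rewrite mulf_eq0 (negbTE (vp_neq0 (vg i))) orbF => /eqP.
Qed.

(** By [vge_Qp_sum] the coordinates of the approximations of [y] form Cauchy sequences; their limits
    lie in [Qp] and are coordinates of [y]. *)
Lemma lspan_Qp_closed (I : finType) (g : I -> L) (x : I -> rat) (y : L) :
  distinct_mod_int x -> (forall i, vp (g i) = (x i)%:E) ->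
  (forall r, exists2 b, lspan (@Qp p L) g b & vge r (y - b)) -> lspan (@Qp p L) g y.
Proof.
(* [M] bounds every [x i] in absolute value and absorbs the loss in passing between a term
   [c i * g i] and its coefficient. *)
move=> dist vg hy; pose M := \sum_i `|x i|.
have xM i : `|x i| <= M by rewrite /M (bigD1 i) //= lerDl sumr_ge0.
have Mx i : x i <= M by apply: le_trans (xM i); exact: ler_norm.
have Nx i : - x i <= M by apply: le_trans (xM i); rewrite -normrN ler_norm.
have /choice [c hc] n : exists c : I -> L,
    (forall i, Qp (c i)) /\ vge (n%:R + M) (y - \sum_i c i * g i).
  by have [b [c Qc ->] hb] := hy (n%:R + M); exists c.
have dc n i : vge n%:R (c n.+1 i - c n i).
  have : vge (n%:R + M) (\sum_i (c n.+1 i - c n i) * g i).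
    rewrite (_ : \sum_i _ = (y - \sum_i c n i * g i) - (y - \sum_i c n.+1 i * g i)); last first.
      under eq_bigr do rewrite mulrBl.
      rewrite sumrB; ring.
    apply: vgeB; first exact: (hc n).2.
    by apply: vge_le (hc n.+1).2; rewrite lerD2r ler_nat.
  have Qd j : Qp (c n.+1 j - c n j) by apply: QpB => //; [exact: (hc _).1 | exact: (hc _).1].
  move=> /(vge_Qp_sum dist vg Qd) /(_ i) h.
  have := vgeM h (vge_fin (vpV_fin (vg i)) (lexx _)).
  rewrite mulfK ?(vp_neq0 (vg i)) //; apply: vge_le; have := Mx i; lra.
have /choice [l hl] i := mn_complete (fun n => dc n i).
exists l => [i|].
  apply: Qp_closed => r; exists (c (Num.truncn `|r|).+1 i); first exact: (hc _).1.
  rewrite -opprB; apply: vgeN; apply: vge_le (hl i _).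
  by apply: le_trans (ler_norm r) _; apply: ltW; exact: truncnS_gt.
apply/eqP; rewrite -subr_eq0; apply/eqP; apply: vge_eq0 => r.
pose n := (Num.truncn (`|r| + M)).+1.
have nr : r + M <= n%:R.
  have h : `|r| + M < n%:R by exact: truncnS_gt.
  by have := ler_norm r; lra.
have M0 : 0 <= M by exact: sumr_ge0.
rewrite (_ : _ - _ = (y - \sum_i c n i * g i) + \sum_i (c n i - l i) * g i); last first.
  under [X in _ = _ + X]eq_bigr do rewrite mulrBl.
  rewrite sumrB; ring.
apply: vgeD; first by apply: vge_le (hc n).2; lra.
apply: vge_sum => i _; apply: vge_le (vgeM (hl i n) (vge_fin (vg i) (lexx _))).
by have := Nx i; lra.
Qed.

(* The powers of [t] realise the [#|I|] classes of (1/#|I|)Z mod Z, so a further class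
   would give more independent elements than the dimension allows. *)
Lemma lspan_Qp_value (I : finType) (g : I -> L) (t a : L) :
  (0 < #|I|)%N -> is_subfield (lspan (@Qp p L) g) -> lspan (@Qp p L) g t ->
  vp t = (#|I|%:R^-1)%:E -> lspan (@Qp p L) g a -> a != 0 ->
  exists k : int, vp a = (k%:~R / #|I|%:R)%:E.
Proof.
set n := #|I| => n0 Vfield Vt vt Va /vp_fin [x vx].
apply: contrapT => nk.
have nR : n%:R != 0 :> rat by rewrite pnatr_eq0 -lt0n.
pose y (i : 'I_n.+1) := if (i < n)%N then t ^+ i else a.
pose v (i : 'I_n.+1) : rat := if (i < n)%N then i%:R / n%:R else x.
have vy i : vp (y i) = (v i)%:E by rewrite /y /v; case: ifP => // _; rewrite (vpX_fin _ vt).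
have xk (i : nat) (k : int) : x - i%:R / n%:R <> k%:~R.
  move=> e; apply: nk; exists (k * n + i); rewrite vx; congr (_%:E).
  rewrite rmorphD rmorphM /= -!pmulrn mulrDl mulfK // -e; ring.
have dist : distinct_mod_int v.
  move=> i j ij k; rewrite /v.
  have ijn : (i : nat) <> j by move=> /val_inj.
  case: ifP => hi; case: ifP => hj e.
  - have e2 : (i : int) - (j : int) = k * n.
      apply: (@intr_inj rat); rewrite rmorphB rmorphM /= -e -!pmulrn.
      by rewrite mulrBl !divfK.
    exact: ijn (ltn_eq_mod_int hi hj e2).
  - by apply: (xk i (- k)); rewrite rmorphN /= -e; ring.
  - exact: (xk j k).
  by move: ijn; have := ltn_ord i; have := ltn_ord j; lia.
have [|c [Qc [i ci] sc]] := @lspan_dependence _ _ _ Qp_subfield _ g y.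
  move=> i; rewrite /y; case: ifP => // _; exact: subfieldX.
by move: ci; rewrite (Qp_free dist vy Qc sc) eqxx.
Qed.

End DistinctValuations.

(** * The recursion step *)

Section TruncatedExp.
Variables (p : nat) (p_prime : prime p) (L : malcevNeumann p).
Implicit Types (a b c x t : L).

(** As polynomials, [texp n.-1] is the derivative of [texp n]; E and its first two derivatives are
    thus [texp p], [texp p.-1] and [texp p.-2]. *)
Definition texp n x : L := \sum_(0 <= k < n) k`!%:R^-1 * x ^+ k.

Definition hexp x : L := \sum_(1 <= k < p) harmonic L k / k`!%:R * x ^+ k.

Lemma vge_harmonic k : (k < p)%N -> vge 0 (harmonic L k).
Proof.
move=> kp; rewrite /harmonic big_nat; apply: vge_sum => j /andP[j0 jk].
by apply: vge_ltV => //; rewrite j0 /=; apply: leq_trans jk _.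
Qed.

Lemma texpS n x : texp n.+1 x = texp n x + n`!%:R^-1 * x ^+ n.
Proof. by rewrite /texp big_nat_recr. Qed.

Lemma vge_texp n x : (n <= p)%N -> vge 0 x -> vge 0 (texp n x).
Proof.
move=> np hx; rewrite /texp big_nat; apply: vge_sum => k /andP[_ kn].
apply: vgeM0; last exact: vgeX0.
by apply: vge_factV => //; exact: leq_trans np.
Qed.

Lemma expr_taylor1 x t n : vge 0 x -> vge 0 t -> exists2 r, vge 0 r &
  (x + t) ^+ n.+1 = x ^+ n.+1 + n.+1%:R * x ^+ n * t + t ^+ 2 * r.
Proof.
move=> hx ht; elim: n => [|n [r hr IH]].
  by exists 0; [exact: vge0 | rewrite !expr1 expr0; ring].
exists (n.+1%:R * x ^+ n + (x + t) * r).
  apply: vgeD; apply: vgeM0 => //; [exact: vge_nat|exact: vgeX0|exact: vgeD].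
by rewrite exprS IH -[n.+2%:R]natr1 !exprS; ring.
Qed.

Lemma expr_taylor2 x t n : vge 0 x -> vge 0 t -> exists2 r, vge 0 r &
  (x + t) ^+ n.+2 = x ^+ n.+2 + n.+2%:R * x ^+ n.+1 * t
     + 'C(n.+2, 2)%:R * x ^+ n * t ^+ 2 + t ^+ 3 * r.
Proof.
move=> hx ht; elim: n => [|n [r hr IH]].
  by exists 0; [exact: vge0 | rewrite binn expr0; ring].
exists ('C(n.+2, 2)%:R * x ^+ n + (x + t) * r).
  apply: vgeD; apply: vgeM0 => //; [exact: vge_nat|exact: vgeX0|exact: vgeD].
rewrite exprS IH (binS n.+2 1) bin1 natrD -[n.+3%:R]natr1 !exprS; ring.
Qed.

(** The remainder is integral because only factorials of numbers below [p] occur as its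
    denominators. *)
Lemma texp_taylor n x t : (n.+2 <= p)%N -> vge 0 x -> vge 0 t ->
  exists2 r, vge 0 r & texp n.+2 (x + t) =
    texp n.+2 x + t * texp n.+1 x + t ^+ 2 * 2%:R^-1 * texp n x + t ^+ 3 * r.
Proof.
move=> np hx ht; elim: n np => [|n IH] np.
  exists 0; first exact: vge0.
  by rewrite !texpS /texp !big_geq // !fact0 invr1 !expr0 !expr1; ring.
have [r hr e] := IH (ltnW np); have [r' hr' e'] := expr_taylor2 n hx ht.
exists (r + n.+2`!%:R^-1 * r').
  by apply: vgeD => //; apply: vgeM0 => //; exact: vge_factV.
rewrite texpS e e' (texpS n.+2) (texpS n.+1 x) (texpS n x).
have f1 : n.+2`!%:R^-1 * n.+2%:R = n.+1`!%:R^-1 :> L.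
  by rewrite factS natrM invfM mulrAC mulVf ?mul1r // (mn_natr_neq0 p_prime).
have f2 : n.+2`!%:R^-1 * 'C(n.+2, 2)%:R = 2%:R^-1 * n`!%:R^-1 :> L.
  have := bin_fact (isT : (2 <= n.+2)%N); rewrite subn2 /= => h.
  have := mn_fact_neq0 p_prime L n.+2; rewrite -h !natrM !mulf_eq0 !negb_or => /and3P[h1 h2 h3].
  have h4 : 2%:R != 0 :> L by rewrite (mn_natr_neq0 p_prime).
  by field; rewrite h1 h3 h4.
have f3 : n`!%:R^-1 = 2%:R * (n.+2`!%:R^-1 * 'C(n.+2, 2)%:R) :> L.
  by rewrite f2 mulrA divff ?mul1r // (mn_natr_neq0 p_prime).
have h2 : 2%:R != 0 :> L by rewrite (mn_natr_neq0 p_prime).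
rewrite -f1 f3; set a := n.+2`!%:R^-1; set b := 'C(_, _)%:R; set m := n.+2%:R.
by field.
Qed.

Lemma texp_expand3 n x : (n.+3 <= p)%N -> vge 0 x -> exists2 w, vge 0 w &
  texp n.+3 x = 1 + x + x ^+ 2 * 2%:R^-1 + x ^+ 3 * w.
Proof.
move=> np hx; elim: n np => [|n IH] np.
  exists 0; first exact: vge0.
  by rewrite !texpS /texp !big_geq // !fact0 invr1 !expr0; ring.
have [w hw e] := IH (ltnW np); exists (w + n.+3`!%:R^-1 * x ^+ n).
  apply: vgeD => //; apply: vgeM0; [exact: vge_factV | exact: vgeX0].
by rewrite texpS e !exprS; ring.
Qed.

Lemma texp_expand1 n x : (n.+1 <= p)%N -> vge 0 x -> exists2 w, vge 0 w &
  texp n.+1 x = 1 + x * w.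
Proof.
move=> np hx; elim: n np => [|n IH] np.
  by exists 0; [exact: vge0 | rewrite texpS /texp big_geq // fact0 invr1 expr0; ring].
have [w hw e] := IH (ltnW np); exists (w + n.+1`!%:R^-1 * x ^+ n).
  apply: vgeD => //; apply: vgeM0; [exact: vge_factV | exact: vgeX0].
by rewrite texpS e !exprS; ring.
Qed.

(** Of the derivative only its value [g 1] at 0 is kept exactly; the rest carries a factor [x],
    which puts it beyond the precision of the application. *)
Lemma power_sum_taylor n (g : nat -> L) x t : vge 0 x -> vge 0 t ->
  (forall k, (0 < k < n.+2)%N -> vge 0 (g k)) ->
  exists w1 w2, [/\ vge 0 w1, vge 0 w2 &
    \sum_(1 <= k < n.+2) g k * (x + t) ^+ k =
    \sum_(1 <= k < n.+2) g k * x ^+ k + t * (g 1%N + x * w1) + t ^+ 2 * w2].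
Proof.
move=> hx ht; elim: n => [|n IH] hg.
  by exists 0, 0; split; [exact: vge0|exact: vge0|rewrite !big_nat1; ring].
have [|w1 [w2 [h1 h2 e]]] := IH.
  by move=> k /andP[k0 kn]; apply: hg; rewrite k0 ltnW.
have [r hr er] := expr_taylor1 n.+1 hx ht.
have hgn : vge 0 (g n.+2) by apply: hg; rewrite ltnSn.
exists (w1 + g n.+2 * n.+2%:R * x ^+ n), (w2 + g n.+2 * r); split.
- apply: vgeD => //; apply: vgeM0; last exact: vgeX0.
  by apply: vgeM0 => //; exact: vge_nat.
- by apply: vgeD => //; exact: vgeM0.
rewrite big_nat_recr //= e er [in RHS]big_nat_recr //= !exprS; ring.
Qed.

Lemma hexp_factor x : vge 0 x -> exists2 w, vge 0 w & hexp x = x * w.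
Proof.
move=> hx; exists (\sum_(1 <= k < p) harmonic L k / k`!%:R * x ^+ k.-1).
  rewrite big_nat; apply: vge_sum => k /andP[k0 kp].
  apply: vgeM0; last exact: vgeX0.
  by apply: vgeM0; [exact: vge_harmonic | exact: vge_factV].
rewrite /hexp mulr_sumr !big_nat; apply: eq_bigr => k /andP[k0 _].
have -> : x ^+ k = x * x ^+ k.-1 by rewrite -exprS prednK.
ring.
Qed.

(** Since k/k! = 1/(k-1)!, the part [c * k] of the coefficient sums to [c x] times the derivative of
    the truncated exponential. *)
Lemma sum_harmonic_coef (c : nat) x :
  \sum_(1 <= k < p) ((c * k)%:R - harmonic L k) / k`!%:R * x ^+ k =
  c%:R * x * texp p.-1 x - hexp x.
Proof.
rewrite /texp /hexp !big_add1 mulr_sumr -sumrB; apply: eq_bigr => k _.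
rewrite natrM exprS factS natrM.
have h1 := mn_natr_neq0 p_prime L (ltn0Sn k); have h2 := mn_fact_neq0 p_prime L k.
move: (k.+1%:R : L) (k`!%:R : L) h1 h2 => k1 k2 h1 h2.
by field; rewrite h1 h2.
Qed.

End TruncatedExp.

(* Valuations are measured in units of [d], the valuation of the uniformizer under construction. *)
Section Step.
Variables (p : nat) (p_prime : prime p) (p_ge3 : (3 <= p)%N) (L : malcevNeumann p) (d : rat).
Let P : rat := p%:R.
Hypotheses (d_gt0 : 0 < d) (d_small : 2 * (P * P) * d <= 1).
Implicit Types (a b x t : L).
Local Notation V r a := (vge (r * d) a).

Let P3 : 3 <= P. Proof. by rewrite /P (ler_nat _ 3). Qed.
Let PP : 3 * P <= P * P. Proof. have := P3; nra. Qed.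

Lemma V_le r s a : s <= r -> V r a -> V s a.
Proof. by move=> sr; apply: vge_le; rewrite ler_pM2r. Qed.

Lemma VM r s a b : V r a -> V s b -> V (r + s) (a * b).
Proof. by move=> ha hb; rewrite mulrDl; exact: vgeM. Qed.

Lemma VX r a n : V r a -> V (n%:R * r) (a ^+ n).
Proof.
move=> ha; elim: n => [|n IH]; first by rewrite !mul0r; exact: vge1.
by rewrite exprS -natr1 [_ * r]mulrDl mul1r addrC; exact: VM.
Qed.

Lemma V0E a : vge 0 a <-> V 0 a.
Proof. by rewrite mul0r. Qed.

Lemma Vnat n : V 0 (n%:R : L).
Proof. by apply/V0E; exact: vge_nat. Qed.

Lemma V1 : V 0 (1 : L). Proof. exact: (Vnat 1). Qed.

Lemma Vinv2 : V 0 (2%:R^-1 : L).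
Proof. by apply/V0E; apply: vge_ltV => //; exact: ltnW p_ge3. Qed.

(** The purpose of [d_small]: at the working precision [2 * (P * P)] the prime itself is
    negligible. *)
Lemma Vp : V (2 * (P * P)) (p%:R : L).
Proof. by rewrite /vge vp_p lee_fin. Qed.

(** Precision bookkeeping: [vmon] derives a lower bound for a monomial from the known bounds of its
    factors, leaving it as an existential variable; [vterm] then compares it with the required
    bound, and [vsum] treats sums termwise. *)
Ltac vmon := lazymatch goal with
  | |- vge _ (?a * ?b) => eapply VM; vmon
  | |- vge _ (?a ^+ _) => eapply VX; vmon
  | |- vge _ (- ?a) => eapply vgeN; vmon
  | |- vge _ (2%:R^-1) => exact Vinv2
  | |- vge _ 1 => exact V1
  | |- vge _ (p%:R) => exact Vp
  | |- vge _ (_%:R) => eapply Vnat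
  | |- _ => eassumption
  end.
Ltac vterm := eapply V_le; cycle 1; [vmon | try (have := P3; have := PP; lra)].
Ltac vsum := lazymatch goal with
  | |- vge _ (?a + ?b) => eapply vgeD; vsum
  | |- vge _ (- (?a + ?b)) => rewrite opprD; vsum
  | |- _ => vterm
  end.

(** Lets the top term lam^(p-1)/(p-1)! of E be replaced by - lam^(p-1), that is mu / lam. *)
Lemma wilson_inv : exists2 r : L, V (2 * (P * P)) r & (p.-1)`!%:R^-1 = -1 + r.
Proof.
have := Wilson (prime_gt1 p_prime); rewrite p_prime => /esym/dvdnP [m hm].
have f0 : (p.-1)`!%:R != 0 :> L by exact: mn_fact_neq0.
have hV : V 0 ((p.-1)`!%:R^-1 : L).
  by apply/V0E; apply: vge_factV => //; rewrite prednK // prime_gt0.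
exists (p%:R * m%:R * (p.-1)`!%:R^-1); first by vterm.
have -> : p%:R * m%:R = (p.-1)`!%:R + 1 :> L by rewrite natr1 hm natrM mulrC.
by rewrite mulrDl divff // mul1r addKr.
Qed.

(* [zt] is zeta_{p^N}, [lam] is lam_N, [sig] is sigma_N and [x] is - pi^{N-1,1}. *)
Section Data.
Variables (c : nat) (lam sig zt x : L).
Let mu := - lam ^+ p.
Let s := mu * sig.
Hypotheses (v_lam : vp lam = (P * d)%:E) (V_sig : V (1 - P) sig).
Hypothesis zt_approx : V (2 * (P * P))
  (zt - (texp p lam * (1 + s) - mu * hexp lam + s ^+ 2 * 2%:R^-1 + s ^+ 2 * lam * 2%:R^-1)).
Hypothesis x_approx : V (2 * (P * P)) (x - (lam + s) * (1 - c%:R * mu)).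

Let E0 := texp p lam.
Let E1 := texp p.-1 lam.
Let E2 := texp p.-2 lam.
Let H := hexp lam.
Let Fk := (p.-1)`!%:R^-1 * lam ^+ p.-1.
(** The bracket of [pi_step] in terms of [x]. Since [p] is odd, the signs cancel in the first sum
    and one minus sign remains in the second, which is therefore added. *)
Let B := zt - texp p x
  + \sum_(1 <= k < p) ((c * k)%:R - harmonic L k) / k`!%:R * x ^+ (p + k).

Let V_lam : V P lam. Proof. by rewrite /vge v_lam. Qed.
Let V_mu : V (P * P) mu.
Proof. by apply: vgeN; exact: VX. Qed.
Let V_s : V (P * P - P + 1) s.
Proof. apply: (V_le _ (VM V_mu V_sig)); lra. Qed.
Let lam0 : vge 0 lam. Proof. by apply/V0E; apply: V_le V_lam; have := P3; lra. Qed.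
Let VE1 : V 0 E1. Proof. by apply/V0E; apply: vge_texp => //; exact: leq_pred. Qed.
Let VE2 : V 0 E2.
Proof. by apply/V0E; apply: vge_texp => //; apply: leq_trans (leq_pred _) (leq_pred _). Qed.
Let VFk : V (P * P - P) Fk.
Proof.
have h0 : V 0 ((p.-1)`!%:R^-1 : L).
  by apply/V0E; apply: vge_factV => //; rewrite prednK // prime_gt0.
have e : (p.-1)%:R = P - 1 :> rat by rewrite /P -{2}(prednK (prime_gt0 p_prime)) -natr1 addrK.
by rewrite /Fk; vterm; rewrite e; lra.
Qed.
Let E0E : E0 = E1 + Fk.
Proof.
have -> : E0 = texp p.-1.+1 lam by congr (texp _ _); rewrite prednK // prime_gt0.
by rewrite texpS.
Qed.

(** Precision [3 * P] is what the square of [zt - 1] needs in order to be known to [4 * P]. *)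
Lemma zt1_approx : exists2 r, V (3 * P) r & zt - 1 = lam + lam ^+ 2 * 2%:R^-1 + s + r.
Proof.
have [w /V0E hw eH] := hexp_factor p_prime lam0.
have [w1 /V0E hw1 e1] : exists2 w, vge 0 w & E0 = 1 + lam + lam ^+ 2 * 2%:R^-1 + lam ^+ 3 * w.
  have -> : E0 = texp (p - 3).+3 lam by rewrite /E0; congr (texp _ _); lia.
  by apply: texp_expand3 => //; lia.
move: zt_approx; set r1 := zt - _ => hr1.
exists (lam ^+ 3 * w1 + (1 + lam * 2%:R^-1 + lam ^+ 2 * w1) * (lam * s)
   - mu * lam * w + s ^+ 2 * 2%:R^-1 + s ^+ 2 * lam * 2%:R^-1 + r1).
  have hE : V 0 (1 + lam * 2%:R^-1 + lam ^+ 2 * w1) by vsum.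
  by vsum.
rewrite /r1 -/E0 e1 eH; ring.
Qed.

Lemma v_zt1 : vp (zt - 1) = (P * d)%:E.
Proof.
have [r hr ->] := zt1_approx; rewrite -!addrA; apply: vp_dominant => //.
have : V (2 * P) (lam ^+ 2 * 2%:R^-1 + (s + r)) by vsum.
apply: lt_le_trans; rewrite lte_fin ltr_pM2r //; have := P3; lra.
Qed.

Let t := x - lam.

Let t_approx : exists2 r, V (2 * (P * P)) r & t = s - c%:R * mu * lam - c%:R * mu * s + r.
Proof.
exists (x - (lam + s) * (1 - c%:R * mu)); first exact: x_approx.
by rewrite /t; ring.
Qed.

Let V_t : V (P * P - P + 1) t.
Proof. by have [r hr ->] := t_approx; vsum. Qed.

Let V_ts : V (P * P + P) (t - s).
Proof.
have [r hr ->] := t_approx.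
rewrite (_ : _ - s = - (c%:R * mu * lam) - c%:R * mu * s + r); last by ring.
by vsum.
Qed.

Let t0 : vge 0 t. Proof. by apply/V0E; apply: V_le V_t; have := P3; have := PP; lra. Qed.

Let x_expp : exists2 r, V (2 * (P * P) - P) r & x ^+ p = - mu + r.
Proof.
have [w /V0E hw e] := exprDp p_prime lam0 t0.
exists (t ^+ p + p%:R * (lam * t) * w); last first.
  by rewrite -[x](subrK lam) -/t [t + lam]addrC e /mu opprK addrA.
apply: vgeD; last by vterm.
have -> : t ^+ p = t ^+ 3 * t ^+ (p - 3) by rewrite -exprD subnKC.
have ht : V 0 (t ^+ (p - 3)) by apply/V0E; exact: vgeX0.
by move: (t ^+ (p - 3)) ht => T hT; vterm.
Qed.

(** The expansion of [zt] and Taylor's formula at [lam] contribute [s (E0 - E1) = s Fk],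
    [c mu (lam + s) E1] and [- mu H]; the last sum contributes [- mu (c lam E1 - H + (c - 1) t)].
    The terms in [lam E1] and [H] cancel, and [c mu s - (c - 1) mu s = mu s] remains, as replacing
    [E1] by 1 and [t] by [s] there is harmless. The quadratic terms leave the factor
    [1 + lam - E2]. *)
Let B_approx : V (2 * (P * P)) (B - (Fk * s + mu * s + s ^+ 2 * 2%:R^-1 * (1 + lam - E2))).
Proof.
move: zt_approx; set r1 := zt - _ => hr1.
have [r2 hr2 et] := t_approx.
have [r3 hr3 exp] := x_expp.
have pE : p = (p - 2).+2 by lia.
have [R /V0E hR eT] : exists2 r, vge 0 r &
    texp p x = E0 + t * E1 + t ^+ 2 * 2%:R^-1 * E2 + t ^+ 3 * r.
  have := @texp_taylor _ p_prime L (p - 2) lam t; rewrite -pE => /(_ (leqnn _) lam0 t0).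
  by rewrite [lam + t]addrC subrK /E1 /E2 (_ : p.-1 = (p - 2).+1) ?(_ : p.-2 = (p - 2)%N) //; lia.
have [w1 /V0E hw1 e1] : exists2 w, vge 0 w & E1 = 1 + lam * w.
  by rewrite /E1 (_ : p.-1 = (p - 2).+1); [apply: texp_expand1 => //; lia | lia].
have [wH /V0E hwH eH] := hexp_factor p_prime lam0.
pose g k := ((c * k)%:R - harmonic L k) / k`!%:R.
have [w2 [w3 [/V0E hw2 /V0E hw3 eG]]] : exists w1 w2, [/\ vge 0 w1, vge 0 w2 &
    \sum_(1 <= k < p) g k * x ^+ k =
    \sum_(1 <= k < p) g k * lam ^+ k + t * (g 1%N + lam * w1) + t ^+ 2 * w2].
  have := @power_sum_taylor _ L (p - 2) g lam t lam0 t0.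
  rewrite -pE [lam + t]addrC subrK; apply=> k /andP[k0 kp].
  apply: vgeM0; last exact: vge_factV.
  by apply: vgeB; [exact: vge_nat | exact: vge_harmonic].
have g1 : g 1%N = c%:R - 1.
  by rewrite /g muln1 /harmonic big_nat1 factS fact0 muln1 !invr1 mulr1.
have eS : \sum_(1 <= k < p) g k * x ^+ (p + k) = (- mu + r3) * \sum_(1 <= k < p) g k * x ^+ k.
  rewrite -exp mulr_sumr; apply: eq_bigr => k _; rewrite exprD; ring.
set G := \sum_(1 <= k < p) g k * x ^+ k in eG eS.
rewrite sum_harmonic_coef // -/E1 -/H g1 in eG.
have VG : V P G.
  have -> : G = c%:R * lam * E1 - lam * wH + t * c%:R - t + t * lam * w2 + t ^+ 2 * w3.
    by rewrite eG /H eH; ring.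
  by vsum.
have -> : B - (Fk * s + mu * s + s ^+ 2 * 2%:R^-1 * (1 + lam - E2)) =
   c%:R * mu * s * lam * w1 - r2 * E1 + r1 - (t - s) * (t + s) * 2%:R^-1 * E2
   - t ^+ 3 * R + (c%:R - 1) * mu * (s - t) - mu * t * lam * w2 - mu * t ^+ 2 * w3
   + r3 * G.
  have eS' : (- mu + r3) * G = - mu * (c%:R * lam * E1 - H) - mu * t * (c%:R - 1)
     - mu * t * lam * w2 - mu * t ^+ 2 * w3 + r3 * G.
    by rewrite mulrDl; congr (_ + _); rewrite eG; ring.
  rewrite /B eS eT eS'.
  have -> : zt = E0 * (1 + s) - mu * H + s ^+ 2 * 2%:R^-1 + s ^+ 2 * lam * 2%:R^-1 + r1.
    by rewrite /r1 /E0 /H; ring.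
  rewrite E0E.
  have -> : c%:R * mu * s * lam * w1 = c%:R * mu * s * (E1 - 1) by rewrite e1; ring.
  have -> : r2 = t - s + c%:R * mu * lam + c%:R * mu * s by rewrite et; ring.
  ring.
have Vts : V (P * P - P + 1) (t + s) by vsum.
have Vst : V (P * P + P) (s - t) by rewrite -opprB; exact: vgeN.
have Vc : V 0 (c%:R - 1 : L) by vsum.
by vsum.
Qed.

(** The factor [lam] completes [lam ^+ p.-1] to [lam ^+ p = - mu], so that by Wilson [lam * Fk] is
    [mu] up to a negligible error. *)
Let lamB_approx : exists2 r, V (2 * (P * P) + P) r &
  lam * B = mu * s + lam * mu * s + s ^+ 2 * lam * 2%:R^-1 * (1 + lam - E2) + r.
Proof.
have hB := B_approx; have [r4 hr4 e4] := wilson_inv.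
have e : lam * Fk = mu - mu * r4.
  rewrite /Fk e4 (_ : lam * _ = (-1 + r4) * (lam * lam ^+ p.-1)); last by ring.
  by rewrite -exprS prednK ?prime_gt0 // /mu; ring.
exists (lam * (B - (Fk * s + mu * s + s ^+ 2 * 2%:R^-1 * (1 + lam - E2))) - mu * r4 * s).
  by vsum.
have -> : mu * r4 * s = mu * s - lam * Fk * s by rewrite e; ring.
ring.
Qed.

Let B_val : V (2 * (P * P) - 2 * P + 1) B.
Proof.
have hB := B_approx.
rewrite -[B](subrK (Fk * s + mu * s + s ^+ 2 * 2%:R^-1 * (1 + lam - E2))).
have hE : V 0 (1 + lam - E2) by vsum.
by apply: vgeD; [vterm | vsum].
Qed.

(** The factor [1 + lam - E2] equals [lam] for p = 3 but starts with - lam^2/2 for p >= 5; hence the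
    case distinction below. *)
Let K := s ^+ 2 * lam * 2%:R^-1 * (1 + lam - E2).

(* For p = 3 the two terms only cancel together: they add up to [(3/2) mu s^2]. *)
Let K_cancel : V (2 * (P * P) + 2) K /\ V (2 * (P * P) + 2 * P) (lam * K + 2%:R * mu * s ^+ 2).
Proof.
have [p3|p3] := eqVneq p 3%N.
  have E2E : E2 = 1.
    have e1 : p.-2 = 1%N by rewrite p3.
    by rewrite /E2 e1 /texp big_nat1 fact0 invr1 expr0 mulr1.
  have KE : K = s ^+ 2 * lam ^+ 2 * 2%:R^-1 by rewrite /K E2E; ring.
  have PE : P = 3 by rewrite /P p3.
  split; first by rewrite KE; vterm.
  have mE : lam ^+ 3 = - mu by rewrite /mu opprK; congr (_ ^+ _).
  have h2 : 2%:R != 0 :> L by rewrite (mn_natr_neq0 p_prime).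
  have -> : lam * K + 2%:R * mu * s ^+ 2 = p%:R * (mu * s ^+ 2) * 2%:R^-1.
    have -> : p%:R = 3%:R :> L by congr (_%:R).
    rewrite KE (_ : lam * _ = lam ^+ 3 * s ^+ 2 * 2%:R^-1); last by ring.
    by rewrite mE; field.
  by vterm.
have p5 : (5 <= p)%N.
  have p4 : p != 4%N by apply: contraTneq p_prime => ->.
  by move: p3 p4 p_ge3; lia.
have P5 : 5 <= P by rewrite /P (ler_nat _ 5).
have PP5 : 5 * P <= P * P by nra.
have [w /V0E hw e] : exists2 w, vge 0 w & E2 = 1 + lam + lam ^+ 2 * 2%:R^-1 + lam ^+ 3 * w.
  rewrite /E2 (_ : p.-2 = (p - 5).+3); last by lia.
  by apply: texp_expand3 => //; lia.
have KE : K = - (s ^+ 2 * lam ^+ 3 * 2%:R^-1 * (2%:R^-1 + lam * w)) by rewrite /K e; ring.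
have h : V 0 (2%:R^-1 + lam * w) by vsum.
split; first by rewrite KE; vterm.
by rewrite KE; vsum; lra.
Qed.

Let zt1_sqr : exists2 r, V (4 * P) r & (zt - 1) ^+ 2 = lam ^+ 2 + lam ^+ 3 + 2%:R * lam * s + r.
Proof.
have [r hr ->] := zt1_approx.
have h2 : 2%:R != 0 :> L by rewrite (mn_natr_neq0 p_prime).
exists (lam ^+ 4 * 2%:R^-1 ^+ 2 + lam ^+ 2 * s + s ^+ 2 + 2%:R * lam * r
   + lam ^+ 2 * r + 2%:R * s * r + r ^+ 2); first by vsum.
by field.
Qed.

(** The product of lam + lam^2 and mu s + lam mu s is lam mu s (1 + lam)^2, the source of
    [1 + 2 lam]. The cross term 2 lam s of the square meets [B] and adds 2 mu s^2, which is paired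
    with [lam * K]. *)
Let leading : V (2 * (P * P) + 2 * P)
  ((zt - 1) ^+ 2 * B - mu * s * lam * (1 + 2%:R * lam)).
Proof.
have [r6 hr6 ->] := zt1_sqr; have [r7 hr7 eB] := lamB_approx.
have [VK Kc] := K_cancel; rewrite -/K in eB.
have hB := B_val.
rewrite (_ : _ - _ = lam ^+ 3 * mu * s + (lam * K + 2%:R * mu * s ^+ 2) + lam ^+ 2 * K
   + 2%:R * lam * mu * s ^+ 2 + 2%:R * s * K + 2%:R * s * r7 + r6 * B
   + lam * r7 + lam ^+ 2 * r7).
  by move: (lam * K + 2%:R * mu * s ^+ 2) Kc => KK hKK; vsum.
rewrite (_ : (_ + r6) * B = (lam + lam ^+ 2 + 2%:R * s) * (lam * B) + r6 * B); last by ring.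
rewrite eB; ring.
Qed.

Let Q := lam * sig * (1 + 2%:R * lam).

(** [(zt - 1) ^+ p] is [- mu] up to higher order and [mu ^+ 2 * sig = mu * s], so this product has
    the same main term as the one in [leading]. Comparing the two spares the expansion of a negative
    power. *)
Let zt1_exp2p : V (2 * (P * P) + 2 * P) ((zt - 1) ^+ (2 * p) * Q - mu * s * lam * (1 + 2%:R * lam)).
Proof.
have [r hr e] := zt1_approx.
pose y := lam ^+ 2 * 2%:R^-1 + s + r.
have hy : V (2 * P) y by rewrite /y; vsum.
have y0 : vge 0 y by apply/V0E; apply: V_le hy; have := P3; lra.
have [w /V0E hw ep] := exprDp p_prime lam0 y0.
pose r8 := y ^+ p + p%:R * (lam * y) * w.
have hr8 : V (2 * (P * P)) r8.
  apply: vgeD; last by vterm.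
  by eapply V_le; [|eapply VX; exact: hy]; rewrite -/P; lra.
have -> : (zt - 1) ^+ (2 * p) = (- mu + r8) ^+ 2.
  rewrite mulnC exprM; congr (_ ^+ 2).
  by rewrite e -!addrA [lam ^+ 2 * _ + _]addrA -/y ep /r8 /mu opprK addrA.
have hQ : V 0 (1 + 2%:R * lam) by vsum.
rewrite (_ : _ - _ = - (2%:R * mu * r8 * lam * sig * (1 + 2%:R * lam))
   + r8 ^+ 2 * lam * sig * (1 + 2%:R * lam)); last by rewrite /Q /s; ring.
by vsum.
Qed.

Lemma pi_step_approx : V (2 * P) (pi_step c zt (- x) - Q).
Proof.
have BE : zt - \sum_(0 <= k < p) (-1) ^+ k / k`!%:R * (- x) ^+ k
      - \sum_(1 <= k < p)
          (-1) ^+ k * ((c * k)%:R - harmonic L k) / k`!%:R * (- x) ^+ (p + k) = B.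
  have podd : odd p by case: (even_prime p_prime) => // p2; move: p_ge3; rewrite p2.
  have sg (k : nat) : (-1) ^+ k * (-1) ^+ k = 1 :> L by rewrite -expr2 sqrr_sign.
  rewrite /B; congr (_ - _ + _).
    apply: eq_bigr => k _; rewrite [(- x) ^+ k]exprNn.
    rewrite (_ : _ * _ = ((-1) ^+ k * (-1) ^+ k) * (k`!%:R^-1 * x ^+ k)); last by ring.
    by rewrite sg mul1r.
  rewrite -sumrN; apply: eq_bigr => k _; rewrite [(- x) ^+ _]exprNn [(-1) ^+ (p + k)]exprD -[(-1) ^+ p]signr_odd podd expr1.
  transitivity (((-1) ^+ k * (-1) ^+ k) * (((c * k)%:R - harmonic L k) / k`!%:R * x ^+ (p + k))); first by ring.
  by rewrite sg mul1r.
rewrite /pi_step BE.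
have z0 := vp_neq0 v_zt1.
have e : (zt - 1) ^+ (2 * p) = (zt - 1) ^+ 2 * (zt - 1) ^+ (2 * p - 2).
  by rewrite -exprD; congr (_ ^+ _); lia.
have -> : (zt - 1) ^- (2 * p - 2) * B - Q = (zt - 1) ^- (2 * p) *
   (((zt - 1) ^+ 2 * B - mu * s * lam * (1 + 2%:R * lam))
    - ((zt - 1) ^+ (2 * p) * Q - mu * s * lam * (1 + 2%:R * lam))).
  by rewrite e; field; rewrite !expf_neq0.
(* Division by [(zt - 1) ^+ (2 * p)] costs exactly [2 * (P * P)], which leaves [2 * P] of the
   precision [2 * (P * P) + 2 * P]. *)
have hz : V (- (2 * (P * P))) ((zt - 1) ^- (2 * p)).
  apply: (vge_fin (vpV_fin (vpX_fin (2 * p) v_zt1))).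
  by rewrite natrM -/P; lra.
have hl := leading; have he := zt1_exp2p.
have hd := vgeB hl he.
by vterm.
Qed.

End Data.
End Step.

(** * Expansions of zeta and pi *)

Section Sigma.
Variables (p : nat) (p_prime : prime p) (L : malcevNeumann p).

Let sig_exp (k : nat) : rat := - (p ^ k)%:R^-1.

Let sig_exp_le j k : (j <= k)%N -> sig_exp j <= sig_exp k.
Proof.
move=> jk; rewrite lerN2 lef_pV2 ?posrE ?ltr0n ?expn_gt0 ?prime_gt0 //.
by rewrite ler_nat leq_pexp2l // prime_gt0.
Qed.

Let sig_exp_lt k : sig_exp k < sig_exp k.+1.
Proof.
rewrite ltrN2 ltf_pV2 ?posrE ?ltr0n ?expn_gt0 ?prime_gt0 //.
by rewrite ltr_nat ltn_exp2l // prime_gt1.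
Qed.

Let sig_fun N (x : rat) : Fpbar p :=
  if `[< exists2 k : nat, (N <= k)%N & x = - ((p ^ k)%:R^-1) >] then 1 else 0.

Let sig_funP N x : (sig_fun N x != 0) = `[< exists2 k : nat, (N <= k)%N & x = sig_exp k >].
Proof. by rewrite /sig_fun; case: asboolP => _; rewrite ?oner_eq0 ?eqxx. Qed.

(** The exponents - 1/p^k increase with k, so a nonempty subset has its minimum at the least
    index. *)
Let sig_wo N : well_ordered_support (sig_fun N).
Proof.
move=> A As [x Ax]; have Ak y : A y -> exists2 k : nat, (N <= k)%N & y = sig_exp k.
  by move=> /As; rewrite /support_of /= sig_funP => /asboolP.
have ex : exists k, `[< A (sig_exp k) >].
  by have [k _ xk] := Ak _ Ax; exists k; apply/asboolP; rewrite -xk.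
case: (ex_minnP ex) => k /asboolP Aek mink; exists (sig_exp k); split=> // y Ay.
have [j _ yj] := Ak _ Ay; rewrite yj; apply: sig_exp_le; apply: mink.
by apply/asboolP; rewrite -yj.
Qed.

Lemma vp_sigma N : vp (sigma L N) = (- (p ^ N)%:R^-1)%:E.
Proof.
rewrite /vp coef_hsum; last exact: sig_wo.
apply: min_supportE; split; rewrite /support_of /=.
  by have := sig_funP N (sig_exp N); rewrite /sig_fun => ->; apply/asboolP; exists N.
move=> y; have := sig_funP N y; rewrite /sig_fun => -> /asboolP [k Nk ->].
exact: sig_exp_le.
Qed.

Lemma sigmaS N : sigma L N = ppow L (- (p ^ N)%:R^-1) + sigma L N.+1.
Proof.
rewrite -[ppow L _]mul1r -(teich1 L) -hsum_monomial /sigma -hsumD; first last.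
- move=> x; rewrite /monomial; case: eqP => [->|]; last by left.
  right; case: asboolP => // -[k Nk e].
  by have := sig_exp_lt N; rewrite {1}/sig_exp e ltNge sig_exp_le.
- exact: sig_wo.
- exact: well_ordered_monomial.
congr hsum; apply: funext => x; rewrite /monomial; case: eqP => [->|ne].
  case: asboolP => [_|]; last by case; exists N.
  case: asboolP => [[k Nk e]|_]; last by rewrite addr0.
  by have := sig_exp_lt N; rewrite {1}/sig_exp e ltNge sig_exp_le.
rewrite add0r; case: asboolP => [[k Nk e]|h]; case: asboolP => [[j Nj ej]|h'] //.
  case: h'; exists k => //; rewrite ltn_neqAle Nk andbT.
  by apply/eqP => kN; apply: ne; rewrite e -kN.
by case: h; exists j => //; exact: ltnW.
Qed.

End Sigma.

(** * Approximations of zeta and pi, by induction on the level *)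

Section Roots.
Variables (p : nat) (p_prime : prime p) (p_ge3 : (3 <= p)%N) (L : malcevNeumann p).
Variables (z : L) (z_prim : (2 * (p - 1)).-primitive_root z).
Variables (zeta : nat -> L) (zetaP : zeta_spec z zeta).
Let P : rat := p%:R.

Let P3 : 3 <= P. Proof. by rewrite /P (ler_nat _ 3). Qed.
Let P0 : P != 0. Proof. by have := P3; lra. Qed.
Let P1 : P - 1 != 0. Proof. by have := P3; lra. Qed.
Let PX n : P ^+ n != 0. Proof. exact: expf_neq0. Qed.
Let podd : odd p.
Proof. by case: (even_prime p_prime) => // p2; move: p_ge3; rewrite p2. Qed.

Let natE n : (p ^ n * (p - 1))%:R = P ^+ n * (P - 1).
Proof. by rewrite natrM natrX natrB // prime_gt0. Qed.

Definition eps N : rat := ((p ^ (N - 1) * (p - 1))%:R)^-1.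
Definition lam N : L := (-1) ^+ N * z * ppow L (eps N).

Let epsE n : eps n.+1 = (P ^+ n * (P - 1))^-1.
Proof. by rewrite /eps subn1 natE. Qed.

Lemma epsS n : eps n.+2 * P = eps n.+1.
Proof. by rewrite !epsE exprS; field; rewrite P0 PX P1. Qed.

Let pinvE n : (p ^ n)%:R^-1 = (P - 1) * eps n.+1.
Proof. by rewrite epsE natrX -/P; field; rewrite PX P1. Qed.

Lemma eps_gt0 N : 0 < eps N.
Proof. by rewrite invr_gt0 ltr0n muln_gt0 expn_gt0 prime_gt0 // subn_gt0 prime_gt1. Qed.

Lemma eps_small n : 2 * eps n.+1 <= 1.
Proof.
have h : eps n.+1 <= (P - 1)^-1.
  rewrite epsE lef_pV2 ?posrE; last 2 first.
  - by apply: mulr_gt0; [apply: exprn_gt0|]; have := P3; lra.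
  - by have := P3; lra.
  rewrite ler_peMl //; first by have := P3; lra.
  by apply: exprn_ege1; have := P3; lra.
have : (P - 1)^-1 <= 2^-1 by rewrite lef_pV2 ?posrE; have := P3; lra.
lra.
Qed.

Lemma z_half : z ^+ (p - 1) = -1.
Proof.
have h : (z ^+ (p - 1)) ^+ 2 = 1 by rewrite -exprM mulnC prim_expr_order.
have : z ^+ (p - 1) != 1.
  rewrite -(prim_order_dvd z_prim) gtnNdvd // ?subn_gt0 ?prime_gt1 //; lia.
by move/eqP: h; rewrite sqrf_eq1 => /orP[/eqP-> /eqP//|/eqP->].
Qed.

Lemma z_expp : z ^+ p = - z.
Proof.
have -> : z ^+ p = z * z ^+ (p - 1) by rewrite -exprS subn1 prednK // prime_gt0.
by rewrite z_half mulrN1.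
Qed.

Lemma vp_z : vp z = 0%:E.
Proof.
have n0 : (0 < 2 * (p - 1))%N by have := prime_gt1 p_prime; lia.
have := @vp_root _ _ z _ 0 n0; rewrite (prim_expr_order z_prim) mul0r; apply.
exact: vp1.
Qed.

Lemma vp_lam N : vp (lam N) = (eps N)%:E.
Proof.
have v1 : vp ((-1) ^+ N : L) = 0%:E.
  by rewrite -signr_odd; case: odd; rewrite /= ?expr1 ?vpN vp1.
by rewrite (vpM_fin (vpM_fin v1 vp_z) (vp_ppow L _)) !add0r.
Qed.

Lemma lamX N k : lam N ^+ k = (-1) ^+ (N * k) * z ^+ k * ppow L (k%:R * eps N).
Proof. by rewrite /lam !exprMn -exprM ppowX. Qed.

Let sgnMp N : (-1) ^+ (N * p) = (-1) ^+ N :> L.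
Proof. by rewrite -signr_odd oddM podd andbT signr_odd. Qed.

Lemma lam_expp N : - lam N ^+ p = (-1) ^+ N * z * ppow L (P * eps N).
Proof. by rewrite lamX sgnMp z_expp -/P; ring. Qed.

Lemma lam_mu n : - lam n.+2 ^+ p = - lam n.+1.
Proof. by rewrite lam_expp mulrC [P * _]mulrC epsS /lam exprS; ring. Qed.

(** The first term of sigma_{N-1} produces - lam_N, because eps_{N-1} - 1/p^(N-1) = eps_N; the tail
    produces the rest. Here N is [n.+2]. *)
Lemma lam_sigma n : lam n.+1 * sigma L n.+1 =
  - (lam n.+2 + - lam n.+2 ^+ p * sigma L n.+2).
Proof.
rewrite lam_mu (sigmaS p_prime) mulrDr.
have -> : lam n.+1 * ppow L (- (p ^ n.+1)%:R^-1) = - lam n.+2.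
  have -> : lam n.+1 * ppow L (- (p ^ n.+1)%:R^-1) =
      (-1) ^+ n.+1 * z * ppow L (eps n.+1 - (p ^ n.+1)%:R^-1).
    by rewrite /lam ppowD mulrA.
  have -> : eps n.+1 - (p ^ n.+1)%:R^-1 = eps n.+2 by rewrite pinvE -epsS; ring.
  by rewrite /lam (exprS _ n.+1); ring.
ring.
Qed.

Lemma zeta_approxE n (s := - lam n.+2 ^+ p * sigma L n.+2) : zeta_approx z n.+2 =
  texp p (lam n.+2) * (1 + s) - (- lam n.+2 ^+ p) * hexp (lam n.+2)
  + s ^+ 2 * 2%:R^-1
  + (-1) ^+ n.+2 / 2%:R * z ^+ 3 * ppow L (2%:R * P * eps n.+2 - (P - 2%:R) * eps n.+3).
Proof.
set l := lam n.+2; set m := - l ^+ p.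
have mE : m = (-1) ^+ n.+2 * z * ppow L (P * eps n.+2) by exact: lam_expp.
have e1 k : k%:R / (p ^ (n.+2 - 1) * (p - 1))%:R = k%:R * eps n.+2 by [].
have e2 : 2%:R / (p ^ (n.+2 - 2) * (p - 1))%:R = 2%:R * P * eps n.+2.
  by rewrite -mulrA [P * _]mulrC epsS epsE subn2 natE.
have e3 : (p - 2)%:R / (p ^ n.+2 * (p - 1))%:R = (P - 2%:R) * eps n.+3.
  by rewrite natrB ?(ltnW p_ge3) // natE epsE.
have lm k : (-1) ^+ (n.+2 * (k + 1)) * z ^+ (k + 1) *
    ppow L ((k + p)%:R / (p ^ (n.+2 - 1) * (p - 1))%:R) = l ^+ k * m.
  rewrite e1 natrD -/P mulrDl ppowD mE /l lamX mulnDr muln1 !exprD expr1; ring.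
rewrite /zeta_approx e2 e3.
have -> : \sum_(0 <= k < p) (-1) ^+ (n.+2 * k) / k`!%:R * z ^+ k
    * ppow L (k%:R / (p ^ (n.+2 - 1) * (p - 1))%:R) = texp p l.
  by apply: eq_bigr => k _; rewrite e1 lamX; ring.
have -> : \sum_(0 <= k < p) (-1) ^+ (n.+2 * (k + 1)) / k`!%:R * z ^+ (k + 1)
    * ppow L ((k + p)%:R / (p ^ (n.+2 - 1) * (p - 1))%:R) * sigma L n.+2 = texp p l * s.
  rewrite /texp mulr_suml; apply: eq_bigr => k _.
  transitivity (k`!%:R^-1 * (l ^+ k * m) * sigma L n.+2); last by rewrite /s -/l -/m; ring.
  by rewrite -lm; ring.
have -> : \sum_(1 <= k < p) harmonic L k / k`!%:R * (-1) ^+ (n.+2 * (k + 1)) * z ^+ (k + 1)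
    * ppow L ((k + p)%:R / (p ^ (n.+2 - 1) * (p - 1))%:R) = m * hexp l.
  rewrite /hexp mulr_sumr; apply: eq_bigr => k _.
  transitivity (harmonic L k / k`!%:R * (l ^+ k * m)); last by ring.
  by rewrite -lm; ring.
have -> : s ^+ 2 * 2%:R^-1 =
    2%:R^-1 * z ^+ 2 * ppow L (2%:R * P * eps n.+2) * sigma L n.+2 ^+ 2.
  have -> : s ^+ 2 = ((-1) ^+ n.+2) ^+ 2 * z ^+ 2 * (ppow L (P * eps n.+2)) ^+ 2 * sigma L n.+2 ^+ 2.
    by rewrite /s -/l -/m mE; ring.
  by rewrite sqrr_sign ppowX mulrA; ring.
ring.
Qed.

(** The unit for the step at level [n.+2], equal to the valuation of the element constructed
    there. *)
Let d n := eps n.+3.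

Lemma d_gt0 n : 0 < d n. Proof. exact: eps_gt0. Qed.

Let Pd n : P * d n = eps n.+2. Proof. by rewrite /d mulrC epsS. Qed.

Lemma d_small n : 2 * (P * P) * d n <= 1.
Proof.
have -> : 2 * (P * P) * d n = 2 * eps n.+1 by rewrite -epsS -Pd; ring.
exact: eps_small.
Qed.

Lemma vp_lam_d n : vp (lam n.+2) = (P * d n)%:E.
Proof. by rewrite vp_lam Pd. Qed.

Lemma vge_sigma n : vge ((1 - P) * d n) (sigma L n.+2).
Proof.
apply: vge_fin (vp_sigma p_prime L _) _; rewrite pinvE /d; lra.
Qed.

(** Let N be [n.+2], a = p^(-1/p^N) the first term of sigma_N and b its tail. The last explicit term
    of the expansion is mu^2 lam a^2 / 2; completing it to s^2 lam / 2 adds mu^2 lam b (2 a + b) /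
    2, which lies beyond the precision. *)
Lemma zeta_close n (s := - lam n.+2 ^+ p * sigma L n.+2) : vge (2 * (P * P) * d n)
  (zeta n.+2 - (texp p (lam n.+2) * (1 + s) - (- lam n.+2 ^+ p) * hexp (lam n.+2)
     + s ^+ 2 * 2%:R^-1 + s ^+ 2 * lam n.+2 * 2%:R^-1)).
Proof.
have [_] := zetaP (isT : (2 <= n.+2)%N); rewrite /eq_bigO zeta_approxE -/s => h.
have h2 : vge (2 * (P * P) * d n) (s ^+ 2 * lam n.+2 * 2%:R^-1 -
   (-1) ^+ n.+2 / 2%:R * z ^+ 3 * ppow L (2%:R * P * eps n.+2 - (P - 2%:R) * eps n.+3)).
  pose a := ppow L (- (p ^ n.+2)%:R^-1); pose b := sigma L n.+3.
  pose l := lam n.+2; pose m := - l ^+ p.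
  have e : (-1) ^+ n.+2 * z ^+ 3 * ppow L (2%:R * P * eps n.+2 - (P - 2%:R) * eps n.+3)
      = m ^+ 2 * l * a ^+ 2.
    have -> : 2%:R * P * eps n.+2 - (P - 2%:R) * eps n.+3 =
       2%:R * (P * eps n.+2) + eps n.+2 + 2%:R * (- (p ^ n.+2)%:R^-1).
      by rewrite pinvE -epsS; ring.
    have sg : ((-1) ^+ n.+2) ^+ 2 = 1 :> L by rewrite sqrr_sign.
    have pw2 x : ppow L (2%:R * x) = ppow L x ^+ 2 by rewrite ppowX.
    rewrite !ppowD !pw2 -/a /m /l lam_expp /lam.
    move: sg; set g := (-1) ^+ n.+2 => sg.
    transitivity (g ^+ 2 * (g * z ^+ 3 * (ppow L (P * eps n.+2) ^+ 2 * ppow L (eps n.+2) * a ^+ 2))).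
      by rewrite sg; ring.
    ring.
  have -> : s ^+ 2 * lam n.+2 * 2%:R^-1 - (-1) ^+ n.+2 / 2%:R * z ^+ 3 *
      ppow L (2%:R * P * eps n.+2 - (P - 2%:R) * eps n.+3) =
      m ^+ 2 * l * (b * (2%:R * a + b)) * 2%:R^-1.
    transitivity (s ^+ 2 * l * 2%:R^-1 - 2%:R^-1 * (m ^+ 2 * l * a ^+ 2)).
      by rewrite -e /l; ring.
    rewrite /s (sigmaS p_prime) -/a -/b -/l -/m; ring.
  have vl : vge (P * d n) l by rewrite /vge vp_lam_d.
  have vm : vge (P * P * d n) m.
    have := vpX_fin p (vp_lam_d n) => /(vge_fin) h'.
    by apply: vgeN; apply: h'; rewrite -/P mulrA.
  have va : vge (- (P - 1) * d n) a.
    by rewrite /vge vp_ppow lee_fin pinvE /d; lra.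
  have vb : vge (- (P - 1) * eps n.+4) b.
    apply: vge_fin (vp_sigma p_prime L _) _; rewrite pinvE; lra.
  have e4 : eps n.+4 * P = d n by exact: epsS.
  have e40 := eps_gt0 n.+4.
  have vab : vge (- (P - 1) * d n) (2%:R * a + b).
    apply: vgeD; first by apply: vgeM0 => //; exact: vge_nat.
    have h' : 0 <= (P - 1) ^+ 2 * eps n.+4 by apply: mulr_ge0; [exact: sqr_ge0 | exact: ltW].
    by apply: vge_le vb; rewrite -e4; lra.
  have v2 : vge 0 (2%:R^-1 : L) by apply: vge_ltV => //; exact: ltnW p_ge3.
  apply: vgeMr0 v2.
  have := vgeM (vgeM (vgeM vm vm) vl) (vgeM vb vab); rewrite -expr2; apply: vge_le.
  rewrite -e4; have := P3; nra.
move: h2; set q1 := s ^+ 2 * lam n.+2 * 2%:R^-1; set q2 := _ * ppow L _ => h2.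
rewrite -/q2 in h.
have h1 : vge (2 * (P * P) * d n) (zeta n.+2 - (texp p (lam n.+2) * (1 + s) -
     (- lam n.+2 ^+ p) * hexp (lam n.+2) + s ^+ 2 * 2%:R^-1 + q2)).
  apply: vge_le h; rewrite subn2 natE.
  have <- : eps n.+1 = (P ^+ n * (P - 1))^-1 by exact: epsE.
  by rewrite -epsS -Pd; lra.
rewrite (_ : _ - _ = (zeta n.+2 - (texp p (lam n.+2) * (1 + s) -
     (- lam n.+2 ^+ p) * hexp (lam n.+2) + s ^+ 2 * 2%:R^-1 + q2)) - (q1 - q2)); last by ring.
exact: vgeB.
Qed.

Lemma zeta1_expand n : exists2 r, vge (3 * P * d n) r &
  zeta n.+2 - 1 = lam n.+2 + lam n.+2 ^+ 2 * 2%:R^-1 - lam n.+2 ^+ p * sigma L n.+2 + r.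
Proof.
have := zt1_approx p_prime p_ge3 (d_gt0 n) (d_small n) (vp_lam_d n) (vge_sigma n) (zeta_close n).
by move=> [r hr e]; exists r => //; rewrite e; ring.
Qed.

(** The coefficient c at level [n.+2], which is also the factor handed to [pi_step] on leaving that
    level. *)
Definition pi_coef n : nat := if n is 0 then 1 else 2.

(** From lam_2^(p-1) = - p^(1/p) follows mu_2 = p^(1/p) lam_2, so dividing s (1 + lam) by p^(1/p)
    gives the main term. Replacing 1/k! by 1/[k!] changes the sum by valuation at least 1, beyond
    the precision. *)
Lemma pi2_close : vge (2 * eps 2)
  (pi2 z zeta - lam 2 * sigma L 2 * (1 + lam 2)).
Proof.
pose l := lam 2; pose m := - l ^+ p; pose s := m * sigma L 2; pose D := d 0.
have vl : vge (P * D) l by rewrite /vge vp_lam_d.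
have D0 : 0 < D by exact: d_gt0.
have l0 : vge 0 l by apply: vge_le vl; have := P3; nra.
have vm : vge (P * P * D) m.
  have := vpX_fin p (vp_lam_d 0) => /(vge_fin) h'.
  by apply: vgeN; apply: h'; rewrite -/P mulrA.
have vs : vge ((P * P - P + 1) * D) s.
  by apply: vge_le (vgeM vm (vge_sigma 0)); rewrite -/D; lra.
have v2 : vge 0 (2%:R^-1 : L) by apply: vge_ltV => //; exact: ltnW p_ge3.
(* The valuation of [p] in the unit [D], needed to compare the error of the Teichmueller lifts with
   the others. *)
have vD : P * P * (P - 1) * D = 1.
  by rewrite /D /d epsE; field; rewrite P0 P1.
have PP : 3 * P <= P * P by have := P3; nra.
have hz := zeta_close 0; cbv zeta in hz; rewrite -/l -/m -/s -/D in hz.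
set zA := texp p l * (1 + s) - _ + _ + _ in hz.
have lp1 : l ^+ (p - 1) = - ppow L P^-1.
  rewrite lamX z_half.
  have -> : (p - 1)%:R * eps 2 = P^-1.
    by rewrite natrB ?prime_gt0 // -/P epsE expr1; field; rewrite P0 P1.
  have -> : (-1) ^+ (2 * (p - 1)) = 1 :> L by rewrite exprM sqrrN !expr1n.
  by rewrite mul1r mulN1r.
have mE : m = ppow L P^-1 * l.
  rewrite /m (_ : l ^+ p = l * l ^+ (p - 1)); last by rewrite -exprS subn1 prednK // prime_gt0.
  by rewrite lp1; ring.
pose T := \sum_(0 <= k < p) (teich L k`!%:R)^-1 * z ^+ k * ppow L (k%:R / (p * (p - 1))%:R).
have hT : vge ((P * P + P) * D) (texp p l - T).
  rewrite /T /texp -sumrB big_nat; apply: vge_sum => k /andP[_ kp].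
  have fk0 := mn_fact_neq0 p_prime L k.
  have tk0 : k`!%:R != 0 :> Fpbar p by rewrite Fpbar_natr_eq0 // prime_ndvd_fact.
  have vt := vp_teich L tk0; have t0 := vp_neq0 vt.
  have -> : k`!%:R^-1 * l ^+ k - (teich L k`!%:R)^-1 * z ^+ k * ppow L (k%:R / (p * (p - 1))%:R) =
     - (k`!%:R - teich L k`!%:R) * (k`!%:R^-1 * (teich L k`!%:R)^-1 * l ^+ k).
    rewrite -mulrA (_ : z ^+ k * ppow L (k%:R / (p * (p - 1))%:R) = l ^+ k); last first.
      by rewrite lamX exprM sqrrN !expr1n mul1r.
    by field; rewrite fk0 t0.
  apply: vgeMr0; last first.
    apply: vgeM0; last exact: vgeX0.
    by apply: vgeM0; [exact: vge_factV | rewrite /vge (vpV_fin vt) oppr0].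
  apply: vgeN; apply: vge_le (natr_teich_vge1 p_prime L _).
  rewrite -vD; have := P3; have : 2 * P + 1 <= P * P by have := P3; nra.
  nra.
have [w hw eE] : exists2 w, vge 0 w & texp p l = 1 + l + l ^+ 2 * 2%:R^-1 + l ^+ 3 * w.
  have -> : texp p l = texp (p - 3).+3 l by congr (texp _ _); lia.
  by apply: texp_expand3 => //; lia.
have [wH hwH eH] := hexp_factor p_prime l0.
have main : vge ((P * P + P) * D) (zeta 2 - T - s * (1 + l)).
  have -> : zeta 2 - T - s * (1 + l) = (zeta 2 - zA) + (texp p l - T)
     + s * (l * l) * (2%:R^-1 + l * w) - m * l * wH + s * s * (2%:R^-1 + l * 2%:R^-1).
    by rewrite /zA eH eE; ring.
  have vlw : vge 0 (2%:R^-1 + l * w) by apply: vgeD => //; exact: vgeM0.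
  have vl2 : vge 0 (2%:R^-1 + l * 2%:R^-1) by apply: vgeD => //; exact: vgeM0.
  apply: vgeD; [apply: vgeB; [apply: vgeD; [apply: vgeD|]|]|] => //.
  - by apply: vge_le hz; nra.
  - by apply: vgeMr0 vlw; apply: vge_le (vgeM vs (vgeM vl vl)); nra.
  - by apply: vgeMr0 hwH; apply: vge_le (vgeM vm vl); nra.
  - by apply: vgeMr0 vl2; apply: vge_le (vgeM vs vs); have := P3; nra.
have -> : pi2 z zeta - lam 2 * sigma L 2 * (1 + lam 2) =
    ppow L (- P^-1) * (zeta 2 - T - s * (1 + l)).
  rewrite /pi2 -/T -/P -/l /s mE ppowN.
  by field; exact: ppow_neq0.
have vp' : vge (- P^-1) (ppow L (- P^-1)) by rewrite /vge vp_ppow.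
apply: vge_le (vgeM vp' main).
have -> : P^-1 = P * (P - 1) * D by rewrite /D /d epsE; field; rewrite P0 P1.
have -> : eps 2 = P * D by rewrite Pd.
lra.
Qed.

(** The error 2 eps_{N-1} at one level is 2 P^2 d in the unit of the next, exactly what
    [pi_step_approx] demands; its output 2 P d is 2 eps_N. *)
Lemma pi_close n : vge (2 * eps n.+2) (pi_from2 z zeta n
  - lam n.+2 * sigma L n.+2 * (1 + (pi_coef n)%:R * lam n.+2)).
Proof.
elim: n => [|n IH]; first by rewrite mul1r; exact: pi2_close.
have -> : pi_from2 z zeta n.+1 = pi_step (pi_coef n) (zeta n.+3) (- - pi_from2 z zeta n).
  by rewrite opprK; case: n {IH}.
have hx : vge (2 * (P * P) * d n.+1) (- pi_from2 z zeta n -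
   (lam n.+3 + - lam n.+3 ^+ p * sigma L n.+3) * (1 - (pi_coef n)%:R * (- lam n.+3 ^+ p))).
  have -> : 2 * (P * P) * d n.+1 = 2 * eps n.+2 by rewrite -epsS -Pd; ring.
  rewrite lam_mu (_ : _ - _ = - (pi_from2 z zeta n
     - lam n.+2 * sigma L n.+2 * (1 + (pi_coef n)%:R * lam n.+2))); first exact: vgeN.
  rewrite lam_sigma lam_mu; ring.
have := pi_step_approx p_prime p_ge3 (d_gt0 n.+1) (d_small n.+1) (vp_lam_d n.+1)
  (vge_sigma n.+1) (zeta_close n.+1) hx.
by congr vge; rewrite -Pd; ring.
Qed.

(** The main term has valuation eps_N - 1/p^N = eps_{N+1}, below the error 2 eps_N. *)
Lemma vp_pi n : vp (pi_from2 z zeta n) = (eps n.+3)%:E.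
Proof.
have e0 := eps_gt0 n.+3; have e1 := eps_gt0 n.+2.
set Q := lam n.+2 * sigma L n.+2 * (1 + (pi_coef n)%:R * lam n.+2).
have vl : vp (lam n.+2 * sigma L n.+2) = (eps n.+3)%:E.
  rewrite (vpM_fin (vp_lam _) (vp_sigma p_prime L _)) pinvE -epsS; congr (_%:E); ring.
have v1 : vp (1 + (pi_coef n)%:R * lam n.+2) = 0%:E.
  apply: vp_dominant (vp1 L) _; apply: (@gt0_vge _ _ _ (eps n.+2)) => //.
  by apply: vgeM0; [exact: vge_nat | rewrite /vge vp_lam].
have vQ := vpM_fin vl v1; rewrite addr0 -/Q in vQ.
rewrite -[pi_from2 _ _ _](subrK Q) addrC; apply: vp_dominant => //.
apply: lt_le_trans (pi_close n); rewrite lte_fin -(epsS n.+1); have := P3; nra.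
Qed.

End Roots.

(** * The field Q_p(zeta_{p^m}, p^(1/p)) *)

Section Membership.
Variables (p : nat) (p_prime : prime p) (p_ge3 : (3 <= p)%N) (L : malcevNeumann p).
Local Notation Qp := (@Qp p L).

Lemma adjoin_subfield (F S : set L) : is_subfield (adjoin F S).
Proof.
split=> [A [hA _]|a b ha hb A hA|a b ha hb A hA].
- exact: (subfield1 hA).
- by apply: (subfieldB hA.1); [exact: ha | exact: hb].
- by apply: (subfield_div hA.1); [exact: ha | exact: hb].
Qed.

Lemma sub_adjoin (F S : set L) : F `|` S `<=` adjoin F S.
Proof. by move=> a ha A [_]; exact. Qed.

Lemma adjoin_min (F S A : set L) : is_subfield A -> F `|` S `<=` A -> adjoin F S `<=` A.
Proof. by move=> hA sub a; apply. Qed.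

Lemma sub_lspan (F : set L) (I J : finType) (g : I -> L) (h : J -> L) :
  is_subfield F -> (forall i, lspan F h (g i)) -> lspan F g `<=` lspan F h.
Proof.
move=> hF gh a [c Fc ->]; apply: lspan_sum => // i _.
exact: lspanZ.
Qed.

Lemma lspan_sub (F : set L) (I : finType) (g : I -> L) (A : set L) :
  is_subfield A -> F `<=` A -> (forall i, A (g i)) -> lspan F g `<=` A.
Proof.
move=> hA FA Ag a [c Fc ->]; apply: (subfield_sum hA) => // i _.
by apply: (subfieldM hA) => //; exact: FA.
Qed.

(** The powers of the primitive p-th root [y = x ^+ (p ^ m)] add up to 0, which is the vanishing of
    the cyclotomic polynomial of index [p ^ m.+1] at [x]. *)
Lemma cyclotomic_relation (x : L) m : (p ^ m.+1).-primitive_root x ->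
  lspan Qp (fun i : 'I_(p ^ m * (p - 1)) => x ^+ i) (x ^+ (p ^ m * (p - 1))).
Proof.
move=> prim; have hQ := Qp_subfield p_prime L.
pose y := x ^+ (p ^ m).
have y1 : y - 1 != 0.
  rewrite subr_eq0 -(prim_order_dvd prim) gtnNdvd ?expn_gt0 ?prime_gt0 //.
  by rewrite ltn_exp2l // prime_gt1.
have yp : y ^+ p = 1 by rewrite /y -exprM -expnSr prim_expr_order.
have s0 : \sum_(i < p) y ^+ i = 0.
  by apply: (mulfI y1); rewrite -subrX1 yp subrr mulr0.
have pE : p = (p - 1).+1 by rewrite subn1 prednK // prime_gt0.
have e : y ^+ (p - 1) = - \sum_(i < p - 1) y ^+ i.
  have s1 : \sum_(i < (p - 1).+1) y ^+ i = 0 by rewrite -pE.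
  by apply/eqP; rewrite -addr_eq0 addrC; move: s1; rewrite big_ord_recr /= => ->.
rewrite exprM -/y e -mulN1r -[-1]/(- (1 : L)); apply: lspanZ => //.
  by apply: (subfieldN hQ) => //; exact: (subfield1 hQ).
apply: lspan_sum => // i _; rewrite /y -exprM.
have h : (p ^ m * i < p ^ m * (p - 1))%N by rewrite ltn_pmul2l ?expn_gt0 ?prime_gt0.
exact: (@lspan_gen _ _ _ hQ _ (fun i : 'I_(p ^ m * (p - 1)) => x ^+ i) (Ordinal h)).
Qed.

Variables (z : L) (z_prim : (2 * (p - 1)).-primitive_root z).
Variables (zeta : nat -> L) (zetaP : zeta_spec z zeta).

Let t := zeta 2 - 1.
Let D := (p * (p - 1))%N.
Let l := lam z 2.

Let D_gt0 : (0 < D)%N.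
Proof. by rewrite muln_gt0 prime_gt0 //= subn_gt0 prime_gt1. Qed.

Let eps2 : eps p 2 = D%:R^-1. Proof. by rewrite /eps /= expn1. Qed.

Let l_expD : l ^+ D = - p%:R.
Proof.
rewrite lamX eps2 divff ?pnatr_eq0 -?lt0n // ppow1.
have -> : z ^+ D = -1.
  have podd : odd p by case: (even_prime p_prime) => // p2; move: p_ge3; rewrite p2.
  by rewrite /D mulnC exprM z_half // -signr_odd podd expr1.
by rewrite exprM sqrrN !expr1n mul1r mulN1r.
Qed.

Let l_expp1 : l ^+ (p - 1) = - ppow L p%:R^-1.
Proof.
rewrite lamX z_half // exprM sqrrN !expr1n mul1r mulN1r eps2 /D.
congr (- ppow L _); rewrite natrM invfM mulrCA divff ?mulr1 //.
by rewrite pnatr_eq0 -lt0n subn_gt0 prime_gt1.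
Qed.

(** Makes the powers [(t / l) ^+ (p ^ k)] tend to 1. *)
Let t_close : vge (eps p 2) (t / l - 1).
Proof.
have vl := vp_lam p_prime p_ge3 z_prim 2; rewrite -/l in vl; have l0 := vp_neq0 vl.
have e0 := eps_gt0 p_prime 2.
have [r hr e] := zeta1_expand p_prime p_ge3 z_prim zetaP 0; rewrite -/t -/l in e.
have P3 : 3 <= p%:R :> rat by rewrite (ler_nat _ 3).
have e3 := epsS p_prime p_ge3 1.
have l2 : vge (2 * eps p 2) (l ^+ 2 * 2%:R^-1).
  apply: vgeMr0; last by apply: vge_ltV => //; exact: ltnW p_ge3.
  by apply: vge_fin (vpX_fin 2 vl) _.
have ls : vge (2 * eps p 2) (l ^+ p * sigma L 2).
  apply: vge_fin (vpM_fin (vpX_fin p vl) (vp_sigma p_prime L 2)) _.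
  have -> : (p ^ 2)%:R^-1 = (p%:R - 1) * eps p 3 :> rat.
    rewrite /eps (_ : (3 - 1)%N = 2%N) // natrM invfM mulrCA natrB ?prime_gt0 //.
    by rewrite divff ?mulr1 // subr_eq0 (eqr_nat _ p 1) gtn_eqF // prime_gt1.
  by rewrite -e3; have := eps_gt0 p_prime 3; nra.
have hr' : vge (2 * eps p 2) r.
  by apply: vge_le hr; rewrite -e3; have := eps_gt0 p_prime 3; nra.
have tl : vge (2 * eps p 2) (t - l).
  rewrite e (_ : _ - l = l ^+ 2 * 2%:R^-1 - l ^+ p * sigma L 2 + r); last by ring.
  by apply: vgeD => //; exact: vgeB.
have -> : t / l - 1 = (t - l) / l by rewrite -(divff l0) -mulrBl.
have := vgeM tl (vge_fin (vpV_fin vl) (lexx _)); apply: vge_le; lra.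
Qed.

Let vp_t : vp t = (eps p 2)%:E.
Proof.
have vl := vp_lam p_prime p_ge3 z_prim 2; rewrite -/l in vl; have l0 := vp_neq0 vl.
have -> : t = l * (1 + (t / l - 1)) by rewrite addrC subrK mulrC divfK.
have v1 : vp (1 + (t / l - 1)) = 0%:E.
  by apply: vp_dominant (vp1 L) _; apply: gt0_vge t_close; exact: eps_gt0.
by rewrite (vpM_fin vl v1) addr0.
Qed.

(* [t^p (t^D / -p)^(1 + p + ... + p^(k-1))] equals [l^p (t/l)^(p^(k+1))], which tends to [l^p]. *)
Lemma lam2_expp_lspan : lspan Qp (fun i : 'I_D => t ^+ i) (l ^+ p).
Proof.
have hQ := Qp_subfield p_prime L.
have vl := vp_lam p_prime p_ge3 z_prim 2; rewrite -/l in vl; have l0 := vp_neq0 vl.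
have [prim _] := zetaP (isT : (2 <= 2)%N).
have rel := cyclotomic_relation prim; rewrite expn1 -/D in rel.
(* The product structure is available for spans on two generators; taking 1 as the second one
   specialises it to Q_p[zeta_{p^2}]. *)
have rel1 : exists2 c : 'I_1 -> L, (forall i, Qp (c i)) & 1 ^+ 1 = \sum_i c i * 1 ^+ i.
  exists (fun=> 1) => [_|]; first exact: (subfield1 hQ).
  by rewrite big_ord1 mul1r !expr1n.
pose R := lspan Qp (@monom2 _ L (zeta 2) 1 D 1).
have RM a b : R a -> R b -> R (a * b) by exact: lspan2M.
have RQ a : Qp a -> R a by exact: lspan2_F.
have R1 : R 1 by apply: RQ; exact: (subfield1 hQ).
have RX a n : R a -> R (a ^+ n).
  by move=> Ra; elim: n => // n IH; rewrite exprS; exact: RM.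
have Rt : R t.
  apply: lspanD => //; first exact: lspan2_x.
  by apply: RQ; apply: (subfieldN hQ) => //; exact: (subfield1 hQ).
have Rsub : R `<=` lspan Qp (fun i : 'I_D => t ^+ i).
  apply: sub_lspan => // -[i j]; rewrite /monom2 /= expr1n mulr1.
  have -> : zeta 2 = t + 1 by rewrite /t subrK.
  rewrite exprD1n; apply: lspan_sum => // k _; rewrite -mulr_natl; apply: lspanZ => //.
    exact: (subfield_nat hQ).
  have kD : (k < D)%N by apply: leq_ltn_trans (ltn_ord i); rewrite -ltnS.
  exact: (@lspan_gen _ _ _ hQ _ (fun i : 'I_D => t ^+ i) (Ordinal kD)).
apply: (@lspan_Qp_closed _ p_prime L _ _ (fun i : 'I_D => i%:R * eps p 2)).
- move=> i j ij k; rewrite eps2 -mulrBl => e.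
  apply: ij; apply: val_inj; apply: (@ltn_eq_mod_int _ _ D k (ltn_ord i) (ltn_ord j)).
  apply: (@intr_inj rat); rewrite rmorphB rmorphM /= -e -!pmulrn divfK //.
  by rewrite pnatr_eq0 -lt0n.
- by move=> i; exact: vpX_fin vp_t.
move=> r; pose k := Num.truncn (`|r| / eps p 2).
pose b := t ^+ D / - p%:R.
pose M := (\sum_(i < k) p ^ i)%N.
exists (t ^+ p * b ^+ M).
  apply: Rsub; apply: (RM); first exact: RX.
  apply: (RX); apply: (RM); first exact: RX.
  by apply: RQ; apply: (subfieldV hQ) => //; apply: (subfieldN hQ) => //; exact: (subfield_nat hQ).
have bE : b = (t / l) ^+ D by rewrite expr_div_n l_expD.
have e : t ^+ p * b ^+ M = l ^+ p * (t / l) ^+ (p ^ k.+1).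
  have -> : (p ^ k.+1 = p + D * M)%N.
    rewrite /D /M subn1 -mulnA -predn_exp -mulnS prednK ?expn_gt0 ?prime_gt0 //.
    by rewrite expnS.
  rewrite exprD exprM -bE mulrA -exprMn; congr (_ ^+ _ * _).
  by rewrite mulrC divfK.
rewrite e -[X in X - _]mulr1 -mulrBr -opprB mulrN; apply: vgeN.
have e0 := eps_gt0 p_prime 2.
have e01 : 0 <= eps p 2 <= 1.
  by apply/andP; split; [exact: ltW | have := eps_small p_prime p_ge3 1; lra].
have vtl : vge 0 (t / l).
  rewrite -[t / l](subrK 1); apply: vgeD; last exact: vge1.
  by apply: vge_le t_close; exact: ltW.
have h := vge_exprpn_sub p_prime k.+1 vtl (vge1 L) e01 t_close.
rewrite expr1n in h; apply: vgeM0.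
  by apply: vgeX0; rewrite /vge vl lee_fin ltW.
apply: vge_le h; apply: le_trans (ler_norm r) _.
rewrite -ler_pdivrMr //; apply: ltW; apply: lt_trans (truncnS_gt _) _.
by rewrite ltr_nat.
Qed.

Variable m : nat.
Hypothesis m_ge2 : (2 <= m)%N.
Let K := Km1 zeta m.

Let K_field : is_subfield K. Proof. exact: adjoin_subfield. Qed.

Let K_Qp : Qp `<=` K.
Proof. by move=> a ha; apply: sub_adjoin; left. Qed.

Let K_root : K (ppow L p%:R^-1).
Proof. by apply: sub_adjoin; right; right. Qed.

(** The chosen roots need not be compatible, but for [N <= m] every [p ^ N]-th root of unity is a
    power of the primitive root [zeta m]. *)
Let K_zeta N : (2 <= N <= m)%N -> K (zeta N).
Proof.
move=> /andP[N2 Nm]; have [prN _] := zetaP N2; have [prm _] := zetaP m_ge2.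
have zm : zeta N ^+ (p ^ m) = 1.
  by rewrite -(subnKC Nm) expnD exprM (prim_expr_order prN) expr1n.
have [i ->] := prim_rootP prm zm; apply: (subfieldX K_field) => //.
by apply: sub_adjoin; right; left.
Qed.

Let K_lam2 : K l.
Proof.
have vl := vp_lam p_prime p_ge3 z_prim 2; rewrite -/l in vl; have l0 := vp_neq0 vl.
have -> : l = l ^+ p / l ^+ (p - 1).
  have -> : l ^+ p = l * l ^+ (p - 1) by rewrite -exprS subn1 prednK // prime_gt0.
  by rewrite mulfK // expf_neq0.
apply: (subfield_div K_field) => //; last by rewrite l_expp1; exact: (subfieldN K_field).
suff h (i : 'I_D) : K (t ^+ i) by exact: (lspan_sub K_field K_Qp h lam2_expp_lspan).
apply: (subfieldX K_field) => //; apply: (subfieldB K_field) => //; last exact: (subfield1 K_field).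
by apply: K_zeta; rewrite m_ge2.
Qed.

(** [z] occurs in the recursion only in [pi2], through z^k p^(k/(p(p-1))) = lam_2^k, so [K_lam2]
    suffices; the Teichmueller lifts lie in [Qp]. *)
Lemma Km1_pi n : (n.+2 <= m)%N -> K (pi_from2 z zeta n).
Proof.
have K_harm k : K (harmonic L k).
  by apply: (subfield_sum K_field) => // j _; apply: (subfieldV K_field) => //; exact: (subfield_nat K_field).
have K_nat j : K j%:R by exact: (subfield_nat K_field).
have K_sgn (k : nat) : K ((-1) ^+ k).
  by apply: (subfieldX K_field) => //; apply: (subfieldN K_field) => //; exact: (subfield1 K_field).
elim: n => [|n IH] nm.
  rewrite /= /pi2; apply: (subfieldM K_field) => //.
    by rewrite ppowN; exact: (subfieldV K_field).
  apply: (subfieldB K_field) => //; first by apply: K_zeta; rewrite nm.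
  apply: (subfield_sum K_field) => // k _.
  have -> : (teich L k`!%:R)^-1 * z ^+ k * ppow L (k%:R / (p * (p - 1))%:R) =
      (teich L k`!%:R)^-1 * l ^+ k.
    by rewrite lamX exprM sqrrN !expr1n mul1r mulrA eps2.
  apply: (subfieldM K_field) => //; last exact: (subfieldX K_field).
  by apply: (subfieldV K_field) => //; apply: K_Qp; exact: Qp_teich_nat.
have Ka := IH (ltnW nm); have Kz : K (zeta n.+3) by exact: K_zeta.
rewrite /= /pi_step; apply: (subfieldM K_field) => //.
  apply: (subfieldV K_field) => //; apply: (subfieldX K_field) => //; apply: (subfieldB K_field) => //.
  exact: (subfield1 K_field).
apply: (subfieldB K_field) => //; last first.
  apply: (subfield_sum K_field) => // k _; apply: (subfieldM K_field) => //; last exact: (subfieldX K_field).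
  apply: (subfield_div K_field) => //; apply: (subfieldM K_field) => //; exact: (subfieldB K_field).
apply: (subfieldB K_field) => //; apply: (subfield_sum K_field) => // k _.
by apply: (subfieldM K_field) => //; [exact: (subfield_div K_field) | exact: (subfieldX K_field)].
Qed.

(** The valuation of [pi_from2 z zeta n] is the reciprocal of the number of spanning products of
    powers of [zeta m] and p^(1/p), which is the situation of [lspan_Qp_value]. *)
Lemma Km1_value a n : m = n.+2 -> K a -> a != 0 ->
  exists k : int, vp a = (k%:~R * eps p n.+3)%:E.
Proof.
move=> mE Ka a0; have hQ := Qp_subfield p_prime L.
have [prim _] := zetaP m_ge2; rewrite {1}mE in prim.
have rel := cyclotomic_relation prim.
pose d := (p ^ n.+1 * (p - 1))%N.
have d0 : (0 < d)%N by rewrite muln_gt0 expn_gt0 prime_gt0 //= subn_gt0 prime_gt1.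
have p0 := prime_gt0 p_prime.
pose y := ppow L p%:R^-1.
have rely : exists2 c : 'I_p -> L, (forall i, Qp (c i)) & y ^+ p = \sum_i c i * y ^+ i.
  have -> : y ^+ p = p%:R * y ^+ (Ordinal p0).
    by rewrite expr0 mulr1 ppowX divff ?ppow1 // pnatr_eq0 -lt0n.
  apply: lspanZ => //; first exact: (subfield_nat hQ).
  exact: (@lspan_gen _ _ _ hQ _ (fun i : 'I_p => y ^+ i)).
pose g := @monom2 _ L (zeta m) y d p.
have Vf : is_subfield (lspan Qp g) by exact: lspan2_subfield.
have KV : K `<=` lspan Qp g.
  apply: adjoin_min => // b [Qb|[->|->]]; first exact: lspan2_F.
    exact: lspan2_x.
  exact: lspan2_y.
have cardE : #|{: 'I_d * 'I_p}| = (p ^ n.+2 * (p - 1))%N.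
  by rewrite card_prod !card_ord /d mulnAC -expnSr.
have epsE : eps p n.+3 = (#|{: 'I_d * 'I_p}|%:R)^-1 by rewrite cardE /eps subn1.
have Kpi := Km1_pi (eq_leq (esym mE)).
have vpi := vp_pi p_prime p_ge3 z_prim zetaP n; rewrite epsE in vpi.
have c0 : (0 < #|{: 'I_d * 'I_p}|)%N by rewrite card_prod !card_ord muln_gt0 d0 p0.
rewrite epsE; exact: (lspan_Qp_value p_prime c0 Vf (KV _ Kpi) vpi (KV _ Ka) a0).
Qed.

End Membership.

Theorem theorem4p1 (p : nat) (p_prime : prime p) (p_ge3 : (3 <= p)%N)
    (Lp : malcevNeumann p)
    (z : Lp) (z_W : witt_ring z) (z_prim : (2 * (p - 1)).-primitive_root z)
    (zeta : nat -> Lp) (zetaP : zeta_spec z zeta)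
    (m : nat) (m_ge3 : (3 <= m)%N) :
  is_uniformizer (Km1 zeta m) (pi_ z zeta m).
Proof.
have [n mE] : exists n, m = n.+2 by exists (m - 2)%N; lia.
have m2 : (2 <= m)%N by exact: ltnW.
have piE : pi_ z zeta m = pi_from2 z zeta n by rewrite /pi_ mE subn2.
have e0 := eps_gt0 p_prime n.+3.
have vpi : vp (pi_ z zeta m) = (eps p n.+3)%:E by rewrite piE; exact: vp_pi.
have Kpi : Km1 zeta m (pi_ z zeta m).
  by rewrite piE; apply: Km1_pi => //; rewrite mE.
split=> //; first by rewrite vpi lte_fin.
move=> a Ka a_pos; exists (a / pi_ z zeta m).
have pi0 := vp_neq0 vpi.
split; last by rewrite mulrC divfK.
  exact: (subfield_div (adjoin_subfield _ _)).
have [->|a0] := eqVneq a 0; first by rewrite mul0r vp0.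
have [k vk] := Km1_value p_prime p_ge3 z_prim zetaP m2 mE Ka a0.
rewrite (vpM_fin vk (vpV_fin vpi)) lee_fin.
move: a_pos; rewrite vk lte_fin pmulr_lgt0 // ltr0z => k0.
have : 1 <= k%:~R :> rat by rewrite (ler1z _ k).
nra.
Qed.
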